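(* Let $L>0$ and $N\ge1$. For every $n\in\{1,\dots,N\}$ and every $\omega>\omega^*:=\frac{\pi^2}{2L^2}$, the orbit $$\mathcal O(\mathbf\Phi_\omega)=\bigl\{e^{i\theta}\bigl(\phi_\omega(\cdot+s),\psi_{1,\omega},\dots,\psi_{n,\omega},0,\dots,0\bigr):\theta\in\mathbb R,\ s\in\mathbb R/(2L\mathbb Z)\bigr\}$$ is orbitally unstable in $H^1(\mathcal G)$ (for the cubic nonlinear Schr\''odinger equation on $\mathcal G$ described in the context).
   Context: The looping-edge graph $\mathcal G$ has edges $e_0=[-L,L]$ and $e_j=[L,\infty)$, $j=1,\dots,N$. Functions on $\mathcal G$ are tuples $\mathbf U=(\phi,\psi_1,\dots,\psi_N)$ with $\phi$ on $[-L,L]$, $\psi_j$ on $[L,\infty)$ (complex valued); $H^s(\mathcal G)=H^s(-L,L)\oplus\bigoplus_{j=1}^NH^s(L,\infty)$. Equation. The cubic NLS $i\mathbf U_t+\Delta\mathbf U+|\mathbf U|^2\mathbf U=0$ (nonlinearity taken componentwise), where $-\Delta$ acts as $-\frac{d^2}{dx^2}$ on each edge and is the self-adjoint operator with domain $$D_{\mathrm{ext}}=\{\mathbf U\in H^2(\mathcal G):\ \phi(-L)=\phi(L),\ \phi'(-L)=\phi'(L),\ \psi_j'(L)=0\ \text{for } j=1,\dots,N\}.$$ Solutions are considered in the energy space $\{\mathbf U\in H^1(\mathcal G):\phi(-L)=\phi(L)\}$, so the equation decouples into the $2L$-periodic cubic NLS on the loop and the cubic NLS with Neumann condition on each half-line.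 Profile. For $\omega>\omega^*$, $\phi_\omega(x)=\eta_1\,\mathrm{dn}\bigl(\tfrac{\eta_1}{\sqrt2}x;k\bigr)$ is the positive dnoidal solution of $f''+f^3-\omega f=0$ of fundamental period $2L$, where $\mathrm{dn}(\cdot;k)$ is the Jacobi dnoidal function of modulus $k\in(0,1)$, $k^2=\frac{2\omega-2\eta_2^2}{2\omega-\eta_2^2}$, $\eta_1^2+\eta_2^2=2\omega$, $0<\eta_2<\eta_1$; $\phi_\omega(\cdot+s)$ denotes the translate of its $2L$-periodic extension. For $j=1,\dots,n$, $\psi_{j,\omega}(x)=\sqrt{2\omega}\,\operatorname{sech}(\sqrt\omega(x-L))$, $x\ge L$. Set $\mathbf\Phi_\omega=(\phi_\omega,\psi_{1,\omega},\dots,\psi_{n,\omega},0,\dots,0)$ with $N-n$ zero components; $e^{i\omega t}\mathbf\Phi_\omega$ is a standing wave. Orbital instability. The orbit is orbitally stable in $H^1(\mathcal G)$ if for every $\varepsilon>0$ there is $\delta>0$ such that every solution with initial datum $\mathbf U(0)$ in the energy space with $\operatorname{dist}_{H^1(\mathcal G)}(\mathbf U(0),\mathcal O(\mathbf\Phi_\omega))<\delta$ is global and satisfies $\operatorname{dist}_{H^1(\mathcal G)}(\mathbf U(t),\mathcal O(\mathbf\Phi_\omega))<\varepsilon$ for all $t$; it is orbitally unstable if it is not orbitally stable. *)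

(* Defs.v *)
From HB Require Import structures.
From mathcomp Require Import all_boot all_order all_algebra.
From mathcomp Require Import complex.
From mathcomp Require Import all_classical all_reals all_analysis.

Set Implicit Arguments.
Unset Strict Implicit.
Unset Printing Implicit Defensive.

Import Order.TTheory GRing.Theory Num.Theory.
Import numFieldNormedType.Exports.

Local Open Scope classical_set_scope.
Local Open Scope ring_scope.

(* The square of the modulus of z, as a real number. *)
Definition sqnormc (R : realType) (z : R[i]) : R :=
  complex.Re z ^+ 2 + complex.Im z ^+ 2.

Definition cexpi (R : realType) (theta : R) : R[i] :=
  (cos theta +i* sin theta)%C.

Definition Cintegral (R : realType) (D : set R) (f : R -> R[i]) : R[i] :=
  ((\int[lebesgue_measure]_(x in D) complex.Re (f x))%R
   +i* (\int[lebesgue_measure]_(x in D) complex.Im (f x))%R)%C.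

Definition is_Cderive (R : realType) (F : R -> R[i]) (t : R) (d : R[i]) : Prop :=
  is_derive t (1 : R) (fun s => complex.Re (F s)) (complex.Re d) /\
  is_derive t (1 : R) (fun s => complex.Im (F s)) (complex.Im d).

Definition L2 (R : realType) (D : set R) (u : R -> R[i]) : Prop :=
  [/\ measurable_fun D (fun x => complex.Re (u x)),
      measurable_fun D (fun x => complex.Im (u x)) &
      lebesgue_measure.-integrable D (fun x => (sqnormc (u x))%:E)].

(* Real-valued C^1 functions with compact support contained in I. *)
Definition test_function (R : realType) (I : set R) (f : R -> R) : Prop :=
  [/\ forall x : R, derivable f x 1,
      continuous (derive1 f) &
      exists K : set R, [/\ compact K, K `<=` I & forall x, ~ K x -> f x = 0]].

Definition weak_derivative (R : realType) (I : set R) (u v : R -> R[i]) : Prop :=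
  forall f : R -> R, test_function I f ->
    Cintegral I (fun x => u x * (derive1 f x)%:C%C) =
    - Cintegral I (fun x => v x * (f x)%:C%C).

(* An element of H^1(I), I an open interval, is given by its continuous
   representative on the closure of I together with a representative of its
   weak derivative; the latter is unique up to a null set, so nothing below
   depends on it except through its class.  Values outside the closure of I are
   never used. *)
Record H1fun (R : realType) (I : set R) := MkH1fun {
  h1_fun :> R -> R[i];
  h1_der : R -> R[i];
  _ : {within closure I, continuous (fun x => complex.Re (h1_fun x))};
  _ : {within closure I, continuous (fun x => complex.Im (h1_fun x))};
  _ : L2 I h1_fun;
  _ : L2 I h1_der;
  _ : weak_derivative I h1_fun h1_der
}.

(* An element of H^2(I): u in H^1(I) with u' in H^1(I), the derivative being
   represented by its continuous representative. *)
Record H2fun (R : realType) (I : set R) := MkH2fun {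
  h2_fun :> H1fun I;
  h2_der : H1fun I;
  _ : h1_der h2_fun = h1_fun h2_der
}.

(* The looping-edge graph: the loop [-L, L] and N half-lines [L, +oo).  Edges
   enter integrals through their interiors; end points are reached through the
   continuous representatives. *)
Definition loop_edge (R : realType) (L : R) : set R := `]- L, L[%classic.
Definition ray_edge (R : realType) (L : R) : set R := `]L, +oo[%classic.

Record Gfun (R : realType) (N : nat) := MkGfun {
  g_loop : R -> R[i];
  g_ray : 'I_N -> R -> R[i]
}.

Record H1G (R : realType) (L : R) (N : nat) := MkH1G {
  h1_loop : H1fun (loop_edge L);
  h1_ray : 'I_N -> H1fun (ray_edge L)
}.

Record H2G (R : realType) (L : R) (N : nat) := MkH2G {
  h2_loop : H2fun (loop_edge L);
  h2_ray : 'I_N -> H2fun (ray_edge L)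
}.

Definition Gfun_of_H1G (R : realType) (L : R) (N : nat) (U : H1G L N) :
    Gfun R N :=
  MkGfun (h1_loop U) (fun j => h1_ray U j).

Definition Gfun_of_H2G (R : realType) (L : R) (N : nat) (V : H2G L N) :
    Gfun R N :=
  MkGfun (h2_loop V) (fun j => h2_ray V j).

Definition G_inner (R : realType) (L : R) (N : nat) (U V : Gfun R N) : R[i] :=
  Cintegral (loop_edge L) (fun x => g_loop U x * (g_loop V x)^*%C)
  + \sum_(j < N)
      Cintegral (ray_edge L) (fun x => g_ray U j x * (g_ray V j x)^*%C).

Definition H1_sqdist (R : realType) (I : set R) (u v : H1fun I) : R :=
  (\int[lebesgue_measure]_(x in I) sqnormc (u x - v x))%R
  + (\int[lebesgue_measure]_(x in I) sqnormc (h1_der u x - h1_der v x))%R.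

Definition H1G_dist (R : realType) (L : R) (N : nat) (U V : H1G L N) : R :=
  Num.sqrt (H1_sqdist (h1_loop U) (h1_loop V)
            + \sum_(j < N) H1_sqdist (h1_ray U j) (h1_ray V j)).

Definition H1G_dist_set (R : realType) (L : R) (N : nat)
    (U : H1G L N) (A : set (H1G L N)) : \bar R :=
  ereal_inf [set (H1G_dist U V)%:E | V in A].

Definition energy_space (R : realType) (L : R) (N : nat) : set (H1G L N) :=
  [set U | h1_loop U (- L) = h1_loop U L].

Definition D_ext (R : realType) (L : R) (N : nat) : set (H2G L N) :=
  [set V | [/\ h2_loop V (- L) = h2_loop V L,
               h2_der (h2_loop V) (- L) = h2_der (h2_loop V) L &
               forall j, h2_der (h2_ray V j) L = 0]].

Definition Laplacian (R : realType) (L : R) (N : nat) (V : H2G L N) :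
    Gfun R N :=
  MkGfun (h1_der (h2_der (h2_loop V))) (fun j => h1_der (h2_der (h2_ray V j))).

Definition cubic (R : realType) (N : nat) (U : Gfun R N) : Gfun R N :=
  MkGfun (fun x => (sqnormc (g_loop U x))%:C%C * g_loop U x)
         (fun j x => (sqnormc (g_ray U j x))%:C%C * g_ray U j x).

(* Energy solutions of i U_t + Delta U + |U|^2 U = 0 on an open time interval J
   containing 0: continuous curves in the energy space satisfying the equation
   tested, in L^2(G), against every V in the domain D_ext of the self-adjoint
   operator Delta (which is moved onto V).  By Ball's theorem on weak solutions
   this is the same as the Duhamel formula for the group generated by
   (Delta, D_ext). *)
Definition nls_solution (R : realType) (L : R) (N : nat)
    (J : set R) (U : R -> H1G L N) : Prop :=
  [/\ [/\ open J, is_interval J & J 0],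
      forall t, J t -> energy_space (U t),
      forall t, J t -> H1G_dist (U s) (U t) @[s --> t] --> (0 : R) &
      forall V : H2G L N, D_ext V -> forall t, J t ->
        exists d : R[i],
          is_Cderive (fun s => G_inner L (Gfun_of_H1G (U s)) (Gfun_of_H2G V)) t d
          /\ 'i%C * d
             + G_inner L (Gfun_of_H1G (U t)) (Laplacian V)
             + G_inner L (cubic (Gfun_of_H1G (U t))) (Gfun_of_H2G V) = 0].

(* Requiring U' and U to coincide on J on the nose is harmless: an extension that
   agrees with U on J only up to the choice of representatives can be replaced
   by U there. *)
Definition maximal_nls_solution (R : realType) (L : R) (N : nat)
    (J : set R) (U : R -> H1G L N) : Prop :=
  nls_solution J U /\
  forall (J' : set R) (U' : R -> H1G L N), nls_solution J' U' ->
    J `<=` J' -> (forall t, J t -> U' t = U t) -> J' = J.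

Definition orbitally_stable (R : realType) (L : R) (N : nat)
    (O : set (H1G L N)) : Prop :=
  forall eps : R, 0 < eps -> exists delta : R, 0 < delta /\
    forall (J : set R) (U : R -> H1G L N), maximal_nls_solution J U ->
      (H1G_dist_set (U 0%R) O < delta%:E)%E ->
      J = setT /\ forall t, (H1G_dist_set (U t) O < eps%:E)%E.

Definition orbitally_unstable (R : realType) (L : R) (N : nat)
    (O : set (H1G L N)) : Prop :=
  ~ orbitally_stable O.

(* F(phi; k) = int_0^phi dtheta / sqrt (1 - k^2 sin^2 theta), an oriented
   integral; k is the modulus (not the parameter m = k^2). *)
Definition ellipticF (R : realType) (k phi : R) : R :=
  let g := fun theta : R => (Num.sqrt (1 - k ^+ 2 * sin theta ^+ 2))^-1 in
  if 0 <= phi then (\int[lebesgue_measure]_(theta in `[0, phi]) g theta)%R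
  else - (\int[lebesgue_measure]_(theta in `[phi, 0%R]) g theta)%R.

(* The Jacobi amplitude is the inverse of F( . ; k), which is an increasing
   bijection of the real line for 0 < k < 1. *)
Definition jacobi_am (R : realType) (x k : R) : R :=
  xget 0 [set phi | ellipticF k phi = x].

Definition jacobi_dn (R : realType) (x k : R) : R :=
  Num.sqrt (1 - k ^+ 2 * sin (jacobi_am x k) ^+ 2).

Definition fundamental_period (R : realType) (f : R -> R) (T : R) : Prop :=
  [/\ 0 < T, periodic f T & forall T', 0 < T' -> periodic f T' -> T <= T'].

Definition dnoidal (R : realType) (eta1 k : R) (x : R) : R :=
  eta1 * jacobi_dn (eta1 / Num.sqrt 2 * x) k.

(* For omega > pi^2 / (2 L^2) these conditions determine (eta1, eta2, k). *)
Definition dnoidal_parameters (R : realType) (L omega eta1 eta2 k : R) : Prop :=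
  [/\ 0 < eta2 < eta1,
      eta1 ^+ 2 + eta2 ^+ 2 = 2 * omega,
      0 < k < 1,
      k ^+ 2 = (2 * omega - 2 * eta2 ^+ 2) / (2 * omega - eta2 ^+ 2) &
      fundamental_period (dnoidal eta1 k) (2 * L)].

Definition sech (R : realType) (x : R) : R := 2 / (expR x + expR (- x)).

Definition half_soliton (R : realType) (L omega x : R) : R :=
  Num.sqrt (2 * omega) * sech (Num.sqrt omega * (x - L)).

(* The orbit of Phi_omega; the rays of index 0, ..., n - 1 carry the solitons.
   The function dnoidal eta1 k is 2L-periodic on the whole line, so it is its
   own periodic extension, and s may range over R instead of R / 2LZ. *)
Definition Phi_orbit (R : realType) (L : R) (N n : nat) (omega eta1 k : R) :
    set (H1G L N) :=
  [set V | exists theta s : R,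
    (forall x : R, - L <= x <= L ->
       h1_loop V x = cexpi theta * (dnoidal eta1 k (x + s))%:C%C) /\
    (forall (j : 'I_N) x, L <= x ->
       h1_ray V j x =
         if (j < n)%N then cexpi theta * (half_soliton L omega x)%:C%C else 0)].

(* Main.v *)
(** The graph decouples: the loop and the half-lines evolve independently, and
    the orbit ties them together only by demanding a common phase.  So keep the
    loop on its standing wave e^{i omega t} phi_omega, but start the half-line
    solitons at a slightly larger frequency b^2 > omega.  This is again an
    explicit global solution, e^{i b^2 t} times the soliton of frequency b^2, and
    its datum tends to Phi_omega in H^1 as b^2 tends to omega.  At time
    pi / (b^2 - omega) the relative phase of loop and half-lines is off by pi, so
    for every theta the phase e^{i theta} is at an obtuse angle with the solution
    either on the loop or on the half-lines; there the distance to the orbit is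
    at least the norm of the profile, whatever b is.

    That the explicit curve is an energy solution amounts to Green's second
    identity against H^2 functions whose derivatives are only weak; it is
    obtained from the fundamental theorem of calculus for weak derivatives,
    proved by testing against cutoffs that steepen at the end points. *)

Require Import Defs.
From mathcomp Require Import all_boot all_order all_algebra.
From mathcomp Require Import complex.
From mathcomp Require Import all_classical all_reals all_analysis.
From mathcomp Require Import measurable_realfun.
From mathcomp Require Import ring lra.

Import Order.TTheory GRing.Theory Num.Theory.
Import numFieldNormedType.Exports.

Local Open Scope classical_set_scope.
Local Open Scope ring_scope.

Set Implicit Arguments.
Unset Strict Implicit.
Unset Printing Implicit Defensive.

(** * Derivatives and square-integrable functions *)
Lemma is_derive_add (R : realType) (f g : R -> R) (x a b : R) :
  is_derive x 1 f a -> is_derive x 1 g b ->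
  is_derive x 1 (fun y => f y + g y) (a + b).
Proof. by move=> ? ?; exact: is_deriveD. Qed.

Lemma is_derive_sub (R : realType) (f g : R -> R) (x a b : R) :
  is_derive x 1 f a -> is_derive x 1 g b ->
  is_derive x 1 (fun y => f y - g y) (a - b).
Proof. by move=> ? ?; exact: is_deriveB. Qed.

Lemma is_derive_mul (R : realType) (f g : R -> R) (x a b : R) :
  is_derive x 1 f a -> is_derive x 1 g b ->
  is_derive x 1 (fun y => f y * g y) (a * g x + f x * b).
Proof.
move=> ? ?; rewrite addrC mulrC (mulrC a).
rewrite (mulrC b); exact: is_deriveM.
Qed.

Lemma is_derive_scale (R : realType) (c : R) (f : R -> R) (x a : R) :
  is_derive x 1 f a -> is_derive x 1 (fun y => c * f y) (c * a).
Proof. by move=> ?; exact: (@is_deriveZ _ _ _ f c). Qed.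

Lemma is_derive_affine (R : realType) (c d x : R) :
  is_derive x 1 (fun y : R => c * y + d) c.
Proof.
rewrite -[X in is_derive _ _ _ X]addr0; apply: is_derive_add.
by rewrite -[X in is_derive _ _ _ X]mulr1; apply: is_derive_scale.
Qed.

Lemma is_derive_comp_affine (R : realType) (f : R -> R) (c d x a : R) :
  is_derive (c * x + d) 1 f a -> is_derive x 1 (fun y => f (c * y + d)) (c * a).
Proof.
move=> fa; rewrite mulrC.
exact: (@is_derive1_comp _ f (fun y => c * y + d) _ _ _ fa (is_derive_affine _ _ _)).
Qed.

Lemma is_derive_continuous (R : realType) (f df : R -> R) :
  (forall x : R, is_derive x (1 : R) f (df x)) -> continuous f.
Proof.
move=> h x; apply: differentiable_continuous; apply/derivable1_diffP.
by case: (h x).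
Qed.

Definition sqint d (T : measurableType d) (R : realType)
    (mu : {measure set T -> \bar R}) (D : set T) (f : T -> R) : Prop :=
  measurable_fun D f /\ mu.-integrable D (fun x => (f x ^+ 2)%:E).

Lemma sqint_mul d (T : measurableType d) (R : realType)
    (mu : {measure set T -> \bar R}) (D : set T) (f g : T -> R) : measurable D ->
  sqint mu D f -> sqint mu D g ->
  mu.-integrable D (EFin \o (fun x => f x * g x)).
Proof.
move=> mD [mf f2] [mg g2].
apply: le_integrable (integrableD mD f2 g2) => //.
  by apply/measurable_EFinP; exact: measurable_funM.
move=> x _; rewrite /= lee_fin (@ger0_norm _ (_ + _)); last first.
  by rewrite addr_ge0// sqr_ge0.
have := sqr_ge0 (f x - g x); have := sqr_ge0 (f x + g x).
by rewrite ler_norml; nra.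
Qed.

Lemma sqint_le d (T : measurableType d) (R : realType)
    (mu : {measure set T -> \bar R}) (D : set T) (f g : T -> R) : measurable D ->
  measurable_fun D g -> (forall x, D x -> `|g x| <= `|f x|) ->
  sqint mu D f -> sqint mu D g.
Proof.
move=> mD mg gf [mf f2]; split=> //.
apply: le_integrable f2 => //.
  by apply/measurable_EFinP; exact: measurable_funX.
move=> x Dx; rewrite /= lee_fin !normrX; have := gf x Dx.
by move=> h; rewrite lerXn2r ?nnegrE.
Qed.

Lemma sqint_add d (T : measurableType d) (R : realType)
    (mu : {measure set T -> \bar R}) (D : set T) (f g : T -> R) : measurable D ->
  sqint mu D f -> sqint mu D g -> sqint mu D (fun x => f x + g x).
Proof.
move=> mD sf sg; have [[mf f2] [mg g2]] := (sf, sg).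
split; first exact: measurable_funD.
have fg := integrableZl mD 2 (sqint_mul mD sf sg).
have H := integrableD mD (integrableD mD f2 g2) fg.
apply: eq_integrable H => // x _ /=.
by congr EFin; ring.
Qed.

Lemma sqint_scale d (T : measurableType d) (R : realType)
    (mu : {measure set T -> \bar R}) (D : set T) (c : R) (f : T -> R) :
  measurable D -> sqint mu D f -> sqint mu D (fun x => c * f x).
Proof.
move=> mD [mf f2]; split; first exact: measurable_funM.
apply: eq_integrable (integrableZl mD (c ^+ 2) f2) => // x _ /=.
by rewrite exprMn.
Qed.

Lemma sqint_sub d (T : measurableType d) (R : realType)
    (mu : {measure set T -> \bar R}) (D : set T) (f g : T -> R) : measurable D ->
  sqint mu D f -> sqint mu D g -> sqint mu D (fun x => f x - g x).
Proof.
move=> mD sf /(sqint_scale (-1) mD) sg.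
rewrite (_ : (fun _ => _) = (fun x => f x + -1 * g x)); first exact: sqint_add.
by apply/funext => x; rewrite mulN1r.
Qed.

Lemma sqint_subset d (T : measurableType d) (R : realType)
    (mu : {measure set T -> \bar R}) (D E : set T) (f : T -> R) :
  measurable D -> measurable E -> D `<=` E -> sqint mu E f -> sqint mu D f.
Proof.
move=> mD mE DE [mf f2]; split; first exact: measurable_funS mf.
exact: integrableS f2.
Qed.

Lemma continuous_integrable_oo (R : realType) (a b : R) (f : R -> R) :
  {within `[a, b], continuous f} ->
  lebesgue_measure.-integrable `]a, b[ (EFin \o f).
Proof.
move=> cf; have := continuous_compact_integrable (@segment_compact _ a b) cf.
by apply: integrableS => //; exact: subset_itv_oo_cc.
Qed.

Lemma continuous_sqint (R : realType) (a b : R) (f : R -> R) :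
  continuous f -> sqint lebesgue_measure `]a, b[%classic f.
Proof.
move=> cf; split.
  have mf : measurable_fun setT f by exact: continuous_measurable_fun.
  exact: (measurable_funTS mf).
apply: (@continuous_integrable_oo _ _ _ (fun x => f x ^+ 2)).
apply: continuous_subspaceT => x.
by apply: (@continuousM _ _ f f x); exact: cf.
Qed.

Lemma complex_ReM (R : realType) (x y : R[i]) :
  complex.Re (x * y) = complex.Re x * complex.Re y - complex.Im x * complex.Im y.
Proof. by case: x y => [a b] [c d]. Qed.

Lemma complex_ImM (R : realType) (x y : R[i]) :
  complex.Im (x * y) = complex.Re x * complex.Im y + complex.Im x * complex.Re y.
Proof. by case: x y => [a b] [c d]. Qed.

Lemma L2_sqint (R : realType) (D : set R) (u : R -> R[i]) :
  @measurable _ (measurableTypeR R) D ->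
  L2 D u -> sqint lebesgue_measure D (fun x => complex.Re (u x)) /\
            sqint lebesgue_measure D (fun x => complex.Im (u x)).
Proof.
move=> mD [mr mi u2]; split; split=> //.
- apply: le_integrable u2 => //.
    by apply/measurable_EFinP; exact: measurable_funX.
  move=> x _; rewrite /= lee_fin ger0_norm ?sqr_ge0// ger0_norm /sqnormc.
    by rewrite lerDl sqr_ge0.
  by rewrite addr_ge0 ?sqr_ge0.
- apply: le_integrable u2 => //.
    by apply/measurable_EFinP; exact: measurable_funX.
  move=> x _; rewrite /= lee_fin ger0_norm ?sqr_ge0// ger0_norm /sqnormc.
    by rewrite lerDr sqr_ge0.
  by rewrite addr_ge0 ?sqr_ge0.
Qed.

Lemma sqint_L2 (R : realType) (D : set R) (u : R -> R[i]) :
  @measurable _ (measurableTypeR R) D ->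
  sqint lebesgue_measure D (fun x => complex.Re (u x)) ->
  sqint lebesgue_measure D (fun x => complex.Im (u x)) -> L2 D u.
Proof.
move=> mD [mr r2] [mi i2]; split=> //.
have := integrableD mD r2 i2; exact: eq_integrable.
Qed.

(** * Smooth functions as elements of H^1 *)
Lemma Rintegral_FTC2 (R : realType) (a b : R) (F f : R -> R) : a < b ->
  (forall x : R, is_derive x (1 : R) F (f x)) -> continuous f ->
  (\int[lebesgue_measure]_(x in `[a, b]) f x)%R = F b - F a.
Proof.
move=> ab dF cf; rewrite /Rintegral (continuous_FTC2 (F := F)) //.
- exact: continuous_subspaceT.
- have cF := is_derive_continuous dF.
  split; first by move=> x _; case: (dF x).
    exact: (cvg_at_right_filter (cF a)).
  exact: (cvg_at_left_filter (cF b)).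
- by move=> x _; rewrite derive1E; case: (dF x).
Qed.

Lemma Rintegral_oo_FTC2 (R : realType) (a b : R) (F f : R -> R) : a < b ->
  (forall x : R, is_derive x (1 : R) F (f x)) -> continuous f ->
  (\int[lebesgue_measure]_(x in `]a, b[) f x)%R = F b - F a.
Proof.
move=> ab dF cf; rewrite -(Rintegral_FTC2 ab dF cf).
have cfab : {within `[a, b], continuous f} by exact: continuous_subspaceT.
rewrite Rintegral_itv_bndo_bndc; last exact: continuous_integrable_oo.
rewrite Rintegral_itv_obnd_cbnd//.
have := continuous_compact_integrable (@segment_compact _ a b) cfab.
by apply: integrableS => //; exact: subset_itv_oc_cc.
Qed.

Lemma Rintegral_support d (T : measurableType d) (R : realType)
    (mu : {measure set T -> \bar R}) (K D E : set T) (h : T -> R) :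
  K `<=` D -> K `<=` E -> (forall x, ~ K x -> h x = 0) ->
  (\int[mu]_(x in D) h x)%R = (\int[mu]_(x in E) h x)%R.
Proof.
move=> KD KE h0.
suff H A : K `<=` A -> (\int[mu]_(x in A) h x)%R = (\int[mu]_x h x)%R.
  by rewrite !H.
move=> KA; rewrite Rintegral_mkcond; congr (Rintegral _ _ _).
apply/funext => x; rewrite patchE; case: ifPn => //.
by rewrite notin_setE => nAx; rewrite h0// => /KA.
Qed.

Lemma compact_segment (R : realType) (K : set R) : compact K ->
  exists2 A : R, 0 < A & forall x, K x -> - A < x < A.
Proof.
move=> /compact_bounded[M [_ HM]]; exists (`|M| + 2).
  by rewrite ltr_wpDl.
move=> x Kx; have := HM (`|M| + 1).
rewrite (le_lt_trans (ler_norm _))// ?ltrDl// => /(_ isT x Kx) /=.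
by rewrite ler_norml => /andP[h1 h2]; lra.
Qed.

Lemma compact_support_integrable (R : realType) (K D : set R) (h : R -> R) :
  compact K -> @measurable _ (measurableTypeR R) D -> continuous h ->
  (forall x, ~ K x -> h x = 0) ->
  lebesgue_measure.-integrable D (EFin \o h).
Proof.
move=> /compact_segment[A A0 KA] mD ch h0.
have H : lebesgue_measure.-integrable `[- A, A] (EFin \o h).
  apply: continuous_compact_integrable; first exact: segment_compact.
  exact: continuous_subspaceT.
have {}H : lebesgue_measure.-integrable setT (EFin \o h).
  have mA : @measurable _ (measurableTypeR R) `[- A, A]%classic.
    exact: measurable_itv.
  have [+ _] := integrable_mkcond (mu := lebesgue_measure) (EFin \o h) mA.
  move=> /(_ H).
  rewrite (_ : (_ \_ _) = EFin \o h)//; apply/funext => x; rewrite patchE.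
  case: ifPn => //; rewrite notin_setE /= in_itv/= => nAx.
  rewrite h0// => /KA /andP[h1 h2]; apply: nAx; rewrite !ltW//.
by apply: integrableS H.
Qed.

Lemma test_functionP (R : realType) (I : set R) (f : R -> R) :
  test_function I f -> exists f' K, [/\ f' = derive1 f, compact K, K `<=` I &
   [/\ forall x : R, is_derive x (1 : R) f (f' x), continuous f',
    forall x, ~ K x -> f x = 0 & forall x, ~ K x -> f' x = 0]].
Proof.
move=> [df cf [K [cK KI fK]]]; exists (derive1 f), K; split=> //; split=> //.
  by move=> x; apply: DeriveDef => //; rewrite derive1E.
move=> x nKx; have oK : open (~` K).
  by apply: closed_openC; exact: compact_closed.
have nK : \near x, f x = cst 0 x.
  have : nbhs x (~` K) by exact: open_nbhs_nbhs.
  by apply: filterS => y /fK.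
by rewrite derive1E (near_eq_derive (1 : R) nK) derive_val.
Qed.

Lemma Rintegral_derive_support (R : realType) (I K : set R) (F f : R -> R) :
  compact K -> K `<=` I -> (forall x : R, is_derive x (1 : R) F (f x)) ->
  continuous f -> (forall x, ~ K x -> F x = 0) -> (forall x, ~ K x -> f x = 0) ->
  (\int[lebesgue_measure]_(x in I) f x)%R = 0.
Proof.
move=> cK KI dF cf F0 f0; have [A A0 KA] := compact_segment cK.
rewrite (@Rintegral_support _ _ R lebesgue_measure K I `[- A, A]%classic f KI _ f0).
  rewrite (Rintegral_FTC2 (F := F))//; last by lra.
  by rewrite !F0 ?subrr// => /KA; rewrite ltxx ?andbF.
by move=> x /KA /andP[h1 h2] /=; rewrite in_itv/= !ltW.
Qed.

Lemma CintegralM (R : realType) (D : set R) (c : R[i]) (h : R -> R) :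
  @measurable _ (measurableTypeR R) D ->
  lebesgue_measure.-integrable D (EFin \o h) ->
  Cintegral D (fun x => c * (h x)%:C%C) =
  c * ((\int[lebesgue_measure]_(x in D) h x)%R)%:C%C.
Proof.
move=> mD ih; rewrite /Cintegral.
under [X in (X +i* _)%C]eq_Rintegral do rewrite complex_ReM /= mulr0 subr0.
under [X in (_ +i* X)%C]eq_Rintegral do rewrite complex_ImM /= mulr0 add0r.
rewrite !RintegralZl//; case: c => a b /=.
by apply/eqP; rewrite eq_complex /= !mulr0 subr0 add0r !eqxx.
Qed.

Definition C1L2 (R : realType) (I : set R) (f f' : R -> R) : Prop :=
  [/\ forall x : R, is_derive x (1 : R) f (f' x), continuous f',
      sqint lebesgue_measure I f & sqint lebesgue_measure I f'].

Section H1_of_real.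
Context (R : realType) (I : set R) (mI : @measurable _ (measurableTypeR R) I).
Variables (f f' : R -> R) (ff' : C1L2 I f f') (c : R[i]).

Lemma C1L2_L2 (h : R -> R) : sqint lebesgue_measure I h ->
  L2 I (fun x => c * (h x)%:C%C).
Proof.
move=> sh; apply: sqint_L2 => //.
  under eq_fun do rewrite complex_ReM /= mulr0 subr0; exact: sqint_scale.
under eq_fun do rewrite complex_ImM /= mulr0 add0r; exact: sqint_scale.
Qed.

Lemma C1L2_weak : weak_derivative I (fun x => c * (f x)%:C%C)
                                    (fun x => c * (f' x)%:C%C).
Proof.
have [df cf' _ _] := ff'; have cf := is_derive_continuous df.
move=> g /test_functionP[g' [K [<- cK KI [dg cg' gK gK']]]].
have cg := is_derive_continuous dg.
have cM (p q : R -> R) : continuous p -> continuous q ->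
    continuous (fun x => p x * q x).
  by move=> cp cq x; apply: (@continuousM _ _ p q x); [exact: cp|exact: cq].
have Kz (p q : R -> R) : (forall x, ~ K x -> q x = 0) ->
    forall x, ~ K x -> p x * q x = 0.
  by move=> q0 x /q0 ->; rewrite mulr0.
rewrite (_ : (fun x => _) = (fun x => c * (f x * g' x)%:C%C)); last first.
  by apply/funext => x; rewrite -mulrA rmorphM.
rewrite (_ : (fun x => c * _ * _) = (fun x => c * (f' x * g x)%:C%C)); last first.
  by apply/funext => x; rewrite -mulrA rmorphM.
have i1 : lebesgue_measure.-integrable I (EFin \o (fun x => f x * g' x)).
  by apply: (compact_support_integrable cK) => //; [exact: cM|exact: Kz].
have i2 : lebesgue_measure.-integrable I (EFin \o (fun x => f' x * g x)).
  by apply: (compact_support_integrable cK) => //; [exact: cM|exact: Kz].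
rewrite !CintegralM// -mulrN -rmorphN; congr (_ * _%:C%C).
apply/eqP; rewrite -subr_eq0 opprK addrC -RintegralD//.
apply/eqP; apply: (@Rintegral_derive_support _ I K (fun x => f x * g x) _ cK KI).
- by move=> x; exact: is_derive_mul.
- move=> x; apply: (@continuousD _ _ _ (fun x => f' x * g x)
    (fun x => f x * g' x) x); exact: cM.
- exact: Kz.
- by move=> x nKx; rewrite gK// gK'// !mulr0 addr0.
Qed.

Lemma C1L2_within (a : R) (h : R -> R) : continuous h ->
  {within closure I, continuous (fun x => a * h x)}.
Proof.
move=> ch; apply: continuous_subspaceT => x.
by apply: (@continuousM _ _ (cst a) h x); [exact: cvg_cst|exact: ch].
Qed.

Lemma C1L2_within_Re :
  {within closure I, continuous (fun x => complex.Re (c * (f x)%:C%C))}.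
Proof.
under eq_fun do rewrite complex_ReM /= mulr0 subr0.
by apply: C1L2_within; apply: is_derive_continuous; case: ff'.
Qed.

Lemma C1L2_within_Im :
  {within closure I, continuous (fun x => complex.Im (c * (f x)%:C%C))}.
Proof.
under eq_fun do rewrite complex_ImM /= mulr0 add0r.
by apply: C1L2_within; apply: is_derive_continuous; case: ff'.
Qed.

Lemma C1L2_L2_fun : L2 I (fun x => c * (f x)%:C%C).
Proof. by apply: C1L2_L2; case: ff'. Qed.

Lemma C1L2_L2_der : L2 I (fun x => c * (f' x)%:C%C).
Proof. by apply: C1L2_L2; case: ff'. Qed.

Definition H1_of_real : H1fun I :=
  MkH1fun C1L2_within_Re C1L2_within_Im C1L2_L2_fun C1L2_L2_der C1L2_weak.

End H1_of_real.

Lemma H1_sqdist_of_real (R : realType) (I : set R)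
    (mI : @measurable _ (measurableTypeR R) I) (f f' g g' : R -> R)
    (hf : C1L2 I f f') (hg : C1L2 I g g') (c : R[i]) :
  H1_sqdist (H1_of_real mI hf c) (H1_of_real mI hg c) =
  sqnormc c * ((\int[lebesgue_measure]_(x in I) (f x - g x) ^+ 2)%R
               + (\int[lebesgue_measure]_(x in I) (f' x - g' x) ^+ 2)%R).
Proof.
have [_ _ sf sf'] := hf; have [_ _ sg sg'] := hg.
have H (p q : R -> R) (x : R) :
    sqnormc (c * (p x)%:C%C - c * (q x)%:C%C) = sqnormc c * (p x - q x) ^+ 2.
  by case: c => a b; rewrite /sqnormc /=; ring.
rewrite /H1_sqdist /= mulrDr; congr (_ + _).
  under eq_Rintegral do rewrite H.
  by rewrite RintegralZl//; case: (sqint_sub mI sf sg).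
under eq_Rintegral do rewrite H.
by rewrite RintegralZl//; case: (sqint_sub mI sf' sg').
Qed.

Lemma H1_sqdist_phase (R : realType) (I : set R)
    (mI : @measurable _ (measurableTypeR R) I) (f f' : R -> R)
    (hf : C1L2 I f f') (c d : R[i]) :
  H1_sqdist (H1_of_real mI hf c) (H1_of_real mI hf d) =
  sqnormc (c - d) * ((\int[lebesgue_measure]_(x in I) (f x) ^+ 2)%R
               + (\int[lebesgue_measure]_(x in I) (f' x) ^+ 2)%R).
Proof.
have [_ _ sf sf'] := hf.
have H (p : R -> R) (x : R) :
    sqnormc (c * (p x)%:C%C - d * (p x)%:C%C) = sqnormc (c - d) * (p x) ^+ 2.
  by case: c d => a b [a' b']; rewrite /sqnormc /=; ring.
rewrite /H1_sqdist /= mulrDr; congr (_ + _).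
  under eq_Rintegral do rewrite H.
  by rewrite RintegralZl//; case: sf.
under eq_Rintegral do rewrite H.
by rewrite RintegralZl//; case: sf'.
Qed.

(** * The fundamental theorem of calculus for weak derivatives *)
Definition oriented_integral (R : realType) (g : R -> R) (x : R) : R :=
  if 0 <= x then (\int[lebesgue_measure]_(t in `[0, x]) g t)%R
  else - (\int[lebesgue_measure]_(t in `[x, 0%R]) g t)%R.

Lemma is_derive_oriented_integral (R : realType) (g : R -> R) :
  continuous g ->
  forall x : R, is_derive x (1 : R) (oriented_integral g) (g x).
Proof.
move=> cg x; pose A : R := - (`|x| + 1).
have gi (a b : R) : lebesgue_measure.-integrable `[a, b] (EFin \o g).
  apply: continuous_compact_integrable; first exact: segment_compact.
  exact: continuous_subspaceT.
pose F (y : R) : R := (\int[lebesgue_measure]_(t in `[A, y]) g t)%R.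
have A0 : A < 0 by rewrite oppr_lt0 ltr_wpDl.
have Ax : A < x.
  by rewrite /A ltrNl (le_lt_trans (ler_norm _))// normrN ltrDl.
have FE y : A < y -> F y - F 0 = oriented_integral g y.
  move=> Ay; rewrite /oriented_integral; case: ifPn => [y0|].
    rewrite /F (Rintegral_itvB (gi A y)); last 2 first.
    - by rewrite bnd_simp ltW.
    - by rewrite bnd_simp.
    rewrite Rintegral_itv_obnd_cbnd//; apply: integrableS (gi 0 y) => //.
    exact: subset_itv_oc_cc.
  rewrite -ltNge => y0; rewrite -opprB /F (Rintegral_itvB (gi A 0)); last 2 first.
  - by rewrite bnd_simp ltW.
  - by rewrite bnd_simp ltW.
  rewrite Rintegral_itv_obnd_cbnd//; apply: integrableS (gi y 0) => //.
  exact: subset_itv_oc_cc.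
have [dF F'] : derivable F x 1 /\ F^`()%classic x = g x.
  apply: (@continuous_FTC1_closed _ g A x (x + 1)); rewrite ?ltrDl//.
  exact: cg.
have dFx : is_derive x (1 : R) (fun y => F y - F 0) (g x).
  rewrite -[X in is_derive _ _ _ X]subr0; apply: is_derive_sub.
  by split; [exact: dF|rewrite -derive1E; exact: F'].
apply: near_eq_is_derive dFx; near=> y; rewrite FE//.
by near: y; exact: lt_nbhsr.
Unshelve. all: by end_near. Qed.

Lemma Rintegral_dominated_cvg d (T : measurableType d) (R : realType)
    (mu : {measure set T -> \bar R}) (D : set T) (f_ : nat -> T -> R)
    (f g : T -> R) : measurable D ->
  (forall n, measurable_fun D (f_ n)) ->
  (forall x, D x -> f_ n x @[n --> \oo] --> f x) ->
  mu.-integrable D (EFin \o g) ->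
  (forall n x, D x -> `|f_ n x| <= g x) ->
  (\int[mu]_(x in D) f_ n x)%R @[n --> \oo] --> (\int[mu]_(x in D) f x)%R.
Proof.
move=> mD mf_ ff ig fg.
have cvgE x : D x -> (f_ n x)%:E @[n --> \oo] --> (f x)%:E.
  by move=> Dx; apply/cvg_EFin; [exact: nearW|exact: ff].
have mE n : measurable_fun D (EFin \o f_ n) by apply/measurable_EFinP.
have fgE n x : D x -> (`|(f_ n x)%:E| <= (EFin \o g) x)%E.
  by move=> Dx; rewrite lee_fin fg.
have mfE : measurable_fun D (EFin \o f).
  exact: (emeasurable_fun_cvg _ _ mE cvgE).
have [fint _ H] := dominated_convergence mD mE mfE (aeW mu cvgE) ig
  (aeW mu (fun x n Dx => fgE n x Dx)).
apply: fine_cvg; rewrite /Rintegral fineK; first exact: H.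
exact: integrable_fin_num.
Qed.

Lemma weighted_average d (T : measurableType d) (R : realType)
    (mu : {measure set T -> \bar R}) (D : set T) (G w : T -> R) (c e : R) :
  measurable D -> mu.-integrable D (EFin \o w) ->
  mu.-integrable D (EFin \o (fun x => G x * w x)) ->
  (forall x, D x -> 0 <= w x) -> (\int[mu]_(x in D) w x)%R = 1 ->
  (forall x, D x -> w x != 0 -> `|c - G x| <= e) ->
  `|c - (\int[mu]_(x in D) (G x * w x))%R| <= e.
Proof.
move=> mD iw iGw w0 w1 Gc.
have icw : mu.-integrable D (EFin \o (fun x => c * w x)).
  exact: (integrableZl mD c iw).
rewrite -[X in `|X - _|]mulr1 -w1 -RintegralZl// -RintegralB//.
have iB : mu.-integrable D (EFin \o (fun x => c * w x - G x * w x)).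
  exact: (integrableB mD icw iGw).
apply: le_trans (le_normr_Rintegral mD iB) _.
rewrite -[leRHS]mulr1 -w1 -RintegralZl//.
apply: le_Rintegral => //; first exact: integrable_norm.
  exact: (integrableZl mD e iw).
move=> x Dx; rewrite -mulrBl normrM (ger0_norm (w0 x Dx)).
have [->|wx] := eqVneq (w x) 0; first by rewrite !mulr0.
by apply: ler_wpM2r; [exact: w0|exact: Gc].
Qed.

Lemma smooth_step (R : realType) : exists S s : R -> R,
  [/\ forall x : R, is_derive x (1 : R) S (s x), continuous s &
   [/\ forall x, 0 <= s x, forall x, x <= 0 -> S x = 0,
      forall x, 1 <= x -> S x = 1, forall x, 0 <= S x <= 1 &
      forall x, s x != 0 -> 0 < x < 1]].
Proof.
pose t (x : R) : R := Num.max 0 (x * (1 - x)).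
have ct : continuous t.
  move=> x.
  apply: (continuous_max (f := (cst 0 : R -> R^o))
                         (g := (fun y : R => y * (1 - y) : R^o)) (x := x)).
    exact: cvg_cst.
  apply: (@continuousM _ _ id (fun x => 1 - x)); first exact: cvg_id.
  by apply: cvgB; [exact: cvg_cst|exact: cvg_id].
have t0 x : 0 <= t x by rewrite /t le_max lexx.
have tn0 x : t x != 0 -> 0 < x < 1.
  rewrite /t; case: (leP (x * (1 - x)) 0) => h; first by rewrite eqxx.
  by move=> _; nra.
pose F := oriented_integral t.
have dF : forall x : R, is_derive x (1 : R) F (t x).
  exact: is_derive_oriented_integral.
have mvt (x y : R) : x < y -> exists2 c, x < c < y & F y - F x = t c * (y - x).
  move=> xy; have [|c] := MVT xy (fun z _ => dF z).
    by apply: continuous_subspaceT; exact: is_derive_continuous dF.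
  by rewrite in_itv/= => cxy ->; exists c.
have homoF x y : x <= y -> F x <= F y.
  rewrite le_eqVlt => /predU1P[->//|xy]; rewrite -subr_ge0.
  have [c _ ->] := mvt _ _ xy; rewrite mulr_ge0// subr_ge0 ltW//.
have F0 : F 0 = 0 by rewrite /F /oriented_integral lexx set_itv1 Rintegral_set1.
have F1 : 0 < F 1.
  have [c /andP[c0 c1]] := mvt _ _ (@ltr01 R); rewrite F0 !subr0 mulr1 => ->.
  by rewrite lt_max mulr_gt0 ?orbT// subr_gt0.
have Fneg x : x <= 0 -> F x = 0.
  rewrite le_eqVlt => /predU1P[->//|x0]; have [c /andP[_ c0]] := mvt _ _ x0.
  have -> : t c = 0.
    by apply: contraTeq (ltW c0) => /tn0 /andP[h _]; rewrite -ltNge.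
  by rewrite mul0r F0 sub0r => /eqP; rewrite oppr_eq0 => /eqP.
have Fge x : 1 <= x -> F x = F 1.
  rewrite le_eqVlt => /predU1P[->//|x0]; have [c /andP[c0 _]] := mvt _ _ x0.
  have -> : t c = 0.
    by apply: contraTeq (ltW c0) => /tn0 /andP[_ h]; rewrite -ltNge.
  by rewrite mul0r => /eqP; rewrite subr_eq0 => /eqP.
exists (fun x => (F 1)^-1 * F x), (fun x => (F 1)^-1 * t x); split.
- by move=> x; exact: is_derive_scale.
- by move=> x; apply: (@continuousM _ _ (cst _) t); [exact: cvg_cst|exact: ct].
split.
- by move=> x; rewrite mulr_ge0// invr_ge0 ltW.
- by move=> x /Fneg ->; rewrite mulr0.
- by move=> x /Fge ->; rewrite mulVf// gt_eqF.
- move=> x; have Fx0 : 0 <= F x.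
    have [h|h] := leP x 0; first by rewrite Fneg.
    by rewrite -F0 homoF// ltW.
  have Fx1 : F x <= F 1.
    by have [h|h] := leP 1 x; [rewrite Fge|exact/homoF/ltW].
  by rewrite mulr_ge0 ?invr_ge0 ?(ltW F1)//= mulrC ler_pdivrMr// mul1r.
- move=> x; rewrite mulf_eq0 negb_or => /andP[_]; exact: tn0.
Qed.

Definition weak_der (R : realType) (I : set R) (p q : R -> R) : Prop :=
  forall f : R -> R, test_function I f ->
  (\int[lebesgue_measure]_(x in I) (p x * derive1 f x))%R =
  - (\int[lebesgue_measure]_(x in I) (q x * f x))%R.

Lemma test_function_subset (R : realType) (I J : set R) (f : R -> R) :
  J `<=` I -> test_function J f -> test_function I f.
Proof.
move=> JI [df cf [K [cK KJ fK]]]; split=> //; exists K; split=> //.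
exact: subset_trans JI.
Qed.

Lemma weak_der_subset (R : realType) (I J : set R) (p q : R -> R) :
  J `<=` I -> weak_der I p q -> weak_der J p q.
Proof.
move=> JI pq f fJ; have := pq f (test_function_subset JI fJ).
have [f' [K [<- cK KJ [_ _ fK f'K]]]] := test_functionP fJ.
have KI := subset_trans KJ JI.
rewrite (@Rintegral_support _ _ _ lebesgue_measure K I J _ KI KJ); last first.
  by move=> x /f'K ->; rewrite mulr0.
rewrite (@Rintegral_support _ _ _ lebesgue_measure K I J _ KI KJ)//.
by move=> x /fK ->; rewrite mulr0.
Qed.

Lemma weak_derivative_Re_Im (R : realType) (I : set R) (u v : R -> R[i]) :
  weak_derivative I u v ->
  weak_der I (fun x => complex.Re (u x)) (fun x => complex.Re (v x)) /\
  weak_der I (fun x => complex.Im (u x)) (fun x => complex.Im (v x)).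
Proof.
have ReC w : complex.Re (Cintegral I w) =
  (\int[lebesgue_measure]_(x in I) complex.Re (w x))%R by [].
have ImC w : complex.Im (Cintegral I w) =
  (\int[lebesgue_measure]_(x in I) complex.Im (w x))%R by [].
have ReN (z : R[i]) : complex.Re (- z) = - complex.Re z by case: z.
have ImN (z : R[i]) : complex.Im (- z) = - complex.Im z by case: z.
move=> uv; split=> f /uv.
- move=> /(congr1 (@complex.Re R)); rewrite ReN !ReC.
  under eq_Rintegral do rewrite complex_ReM /= mulr0 subr0.
  by under [X in _ = - X]eq_Rintegral do rewrite complex_ReM /= mulr0 subr0.
- move=> /(congr1 (@complex.Im R)); rewrite ImN !ImC.
  under eq_Rintegral do rewrite complex_ImM /= mulr0 add0r.
  by under [X in _ = - X]eq_Rintegral do rewrite complex_ImM /= mulr0 add0r.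
Qed.

Section weak_ftc.
Context (R : realType) (a b : R) (ab : a < b).
Variables (S s : R -> R).
Hypotheses (dS : forall x : R, is_derive x (1 : R) S (s x)) (cs : continuous s).
Hypotheses (s0 : forall x, 0 <= s x) (Sneg : forall x, x <= 0 -> S x = 0)
  (Sge : forall x, 1 <= x -> S x = 1) (S01 : forall x, 0 <= S x <= 1)
  (sn0 : forall x, s x != 0 -> 0 < x < 1).

Let I := `]a, b[%classic.

Let mI : @measurable _ (measurableTypeR R) I.
Proof. exact: measurable_itv. Qed.

(* A difference rather than a product of two steps, so that the derivative is the
   difference of two weights of mass one concentrating at the end points. *)
Definition cutoff (h x : R) : R :=
  S (h^-1 * x - (a / h + 1)) - S (h^-1 * x - (b / h - 2)).

Definition dcutoff (h x : R) : R :=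
  h^-1 * s (h^-1 * x - (a / h + 1)) - h^-1 * s (h^-1 * x - (b / h - 2)).

Lemma affine_scale (h c k x : R) : 0 < h ->
  h^-1 * x - (c / h + k) = (x - (c + k * h)) / h.
Proof. by move=> h0; field; rewrite gt_eqF. Qed.

Lemma is_derive_cutoff (h x : R) :
  is_derive x (1 : R) (cutoff h) (dcutoff h x).
Proof.
by apply: is_derive_sub; apply: is_derive_comp_affine; exact: dS.
Qed.

Lemma continuous_comp_affine (f : R -> R) (c d : R) :
  continuous f -> continuous (fun x => c * f (c * x + d)).
Proof.
move=> cf x; apply: (@continuousM _ _ (cst c) (fun x => f (c * x + d))).
  exact: cvg_cst.
apply: (@continuous_comp _ _ _ (fun x => c * x + d) f); last exact: cf.
have da y := @is_derive_affine R c d y.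
exact: is_derive_continuous da x.
Qed.

Lemma continuous_dcutoff (h : R) : continuous (dcutoff h).
Proof.
by move=> x; apply: cvgB; exact: continuous_comp_affine.
Qed.

Lemma left_weight (h x : R) : 0 < h -> s (h^-1 * x - (a / h + 1)) != 0 ->
  a < x < a + 2 * h.
Proof.
move=> h0 /sn0; rewrite affine_scale// ltr_pdivlMr// ltr_pdivrMr//.
by rewrite mul0r mul1r => /andP[]; lra.
Qed.

Lemma right_weight (h x : R) : 0 < h -> s (h^-1 * x - (b / h - 2)) != 0 ->
  b - 2 * h < x < b.
Proof.
move=> h0 /sn0; rewrite affine_scale// ltr_pdivlMr// ltr_pdivrMr//.
by rewrite mul0r mul1r => /andP[]; lra.
Qed.

Lemma cutoff_test (h : R) : 0 < h -> 3 * h <= b - a ->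
  test_function I (cutoff h).
Proof.
move=> h0 hab; have d1 : derive1 (cutoff h) = dcutoff h.
  by apply/funext => x; rewrite derive1E; case: (is_derive_cutoff h x).
split.
- by move=> x; case: (is_derive_cutoff h x).
- by rewrite d1; exact: continuous_dcutoff.
- exists `[a + h, b - h]%classic; split; first exact: segment_compact.
    by move=> x; rewrite /I /= !in_itv/= => /andP[? ?]; apply/andP; split; lra.
  move=> x; rewrite /= in_itv/= => /negP; rewrite negb_and -!ltNge.
  rewrite /cutoff !affine_scale// => /orP[xa|xb].
    by rewrite !Sneg ?subrr// ler_pdivrMr// mul0r; lra.
  by rewrite !Sge ?subrr// ler_pdivlMr// mul1r; lra.
Qed.

Lemma cutoff_le1 (h x : R) : `|cutoff h x| <= 1.
Proof.
rewrite /cutoff; set u := S _; set v := S _.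
have /andP[u0 u1] : 0 <= u <= 1 by exact: S01.
have /andP[v0 v1] : 0 <= v <= 1 by exact: S01.
by rewrite ler_norml; lra.
Qed.

Lemma cutoff_eq1 (h x : R) : 0 < h -> a + 2 * h <= x -> x <= b - 2 * h ->
  cutoff h x = 1.
Proof.
move=> h0 ax xb; rewrite /cutoff !affine_scale// Sge ?Sneg ?subr0//.
  by rewrite ler_pdivrMr// mul0r; lra.
by rewrite ler_pdivlMr// mul1r; lra.
Qed.

Lemma weight_integral (h c k : R) : 0 < h -> h^-1 * a - (c / h + k) <= 0 ->
  1 <= h^-1 * b - (c / h + k) ->
  (\int[lebesgue_measure]_(x in I) (h^-1 * s (h^-1 * x - (c / h + k))))%R = 1.
Proof.
move=> h0 ha hb.
have dF x : is_derive x (1 : R) (fun x => S (h^-1 * x - (c / h + k)))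
    (h^-1 * s (h^-1 * x - (c / h + k))).
  by apply: is_derive_comp_affine; exact: dS.
rewrite (Rintegral_oo_FTC2 ab dF); first by rewrite (Sge hb) (Sneg ha) subr0.
exact: continuous_comp_affine.
Qed.

Variables (G H : R -> R).
Hypotheses (cG : {within `[a, b], continuous G})
  (iH : lebesgue_measure.-integrable I (EFin \o H)) (GH : weak_der I G H).

Lemma integrable_mul_continuous (w : R -> R) : continuous w ->
  lebesgue_measure.-integrable I (EFin \o (fun x => G x * w x)).
Proof.
move=> cw; apply: (@continuous_integrable_oo _ _ _ (fun x => G x * w x)) => x.
by apply: cvgM; [exact: cG|exact: (continuous_subspaceT cw)].
Qed.

Lemma dcutoff_average (h e : R) : 0 < h -> 3 * h <= b - a ->
  (forall x, a < x < a + 2 * h -> `|G a - G x| <= e) ->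
  (forall x, b - 2 * h < x < b -> `|G b - G x| <= e) ->
  `|G a - G b - (\int[lebesgue_measure]_(x in I) (G x * dcutoff h x))%R|
    <= e + e.
Proof.
move=> h0 hab Ga Gb.
pose wl x := h^-1 * s (h^-1 * x - (a / h + 1)).
pose wr x := h^-1 * s (h^-1 * x - (b / h - 2)).
have cwl : continuous wl by exact: continuous_comp_affine.
have cwr : continuous wr by exact: continuous_comp_affine.
have il (w : R -> R) : continuous w ->
    lebesgue_measure.-integrable I (EFin \o w).
  by move=> cw; apply: continuous_integrable_oo; exact: continuous_subspaceT.
have -> : (\int[lebesgue_measure]_(x in I) (G x * dcutoff h x))%R =
    (\int[lebesgue_measure]_(x in I) (G x * wl x))%R -
    (\int[lebesgue_measure]_(x in I) (G x * wr x))%R.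
  rewrite -RintegralB//; first by apply: eq_Rintegral => x _; rewrite -mulrBr.
    exact: integrable_mul_continuous.
  exact: integrable_mul_continuous.
have L : `|G a - (\int[lebesgue_measure]_(x in I) (G x * wl x))%R| <= e.
  apply: weighted_average => //.
  - exact: il.
  - exact: integrable_mul_continuous.
  - by move=> x _; rewrite mulr_ge0// invr_ge0 ltW.
  - apply: weight_integral => //; rewrite affine_scale//.
      by rewrite ler_pdivrMr// mul0r; lra.
    by rewrite ler_pdivlMr// mul1r; lra.
  - move=> x _; rewrite mulf_eq0 negb_or => /andP[_ sx].
    by apply: Ga; exact: left_weight sx.
have L' : `|G b - (\int[lebesgue_measure]_(x in I) (G x * wr x))%R| <= e.
  apply: weighted_average => //.
  - exact: il.
  - exact: integrable_mul_continuous.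
  - by move=> x _; rewrite mulr_ge0// invr_ge0 ltW.
  - apply: weight_integral => //; rewrite affine_scale//.
      by rewrite ler_pdivrMr// mul0r; lra.
    by rewrite ler_pdivlMr// mul1r; lra.
  - move=> x _; rewrite mulf_eq0 negb_or => /andP[_ sx].
    by apply: Gb; exact: right_weight sx.
rewrite (_ : _ - _ - _ = (G a - (\int[lebesgue_measure]_(x in I) (G x * wl x))%R)
  - (G b - (\int[lebesgue_measure]_(x in I) (G x * wr x))%R)); last by ring.
by apply: le_trans (ler_normB _ _) _; exact: lerD.
Qed.

Lemma weak_ftc_cutoff :
  (\int[lebesgue_measure]_(x in I) H x)%R = G b - G a.
Proof.
pose h n : R := (b - a) / 4 * n.+1%:R^-1.
have h0 n : 0 < h n by rewrite mulr_gt0 ?invr_gt0 ?divr_gt0 ?subr_gt0.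
have hab n : 3 * h n <= b - a.
  have : h n <= (b - a) / 4.
    by rewrite ler_piMr ?divr_ge0 ?subr_ge0 ?(ltW ab)// invf_le1 ?ler1n.
  by have := ab; lra.
have hlt e : 0 < e -> \forall n \near \oo, h n < e.
  move=> e0; have e1 : 0 < e / ((b - a) / 4).
    by rewrite divr_gt0// divr_gt0// subr_gt0.
  have := near_infty_natSinv_lt (PosNum e1); apply: filterS => n /=.
  by rewrite ltr_pdivlMr ?divr_gt0 ?subr_gt0// mulrC.
have mH : measurable_fun I H by apply/measurable_EFinP; case/integrableP: iH.
have cvH : (\int[lebesgue_measure]_(x in I) (H x * cutoff (h n) x))%R
    @[n --> \oo] --> (\int[lebesgue_measure]_(x in I) H x)%R.
  apply: (@Rintegral_dominated_cvg _ _ R lebesgue_measure I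
    (fun n x => H x * cutoff (h n) x) H (fun x => `|H x|)) => //.
  - move=> n; apply: measurable_funM => //.
    have cc : continuous (cutoff (h n)).
      by apply: is_derive_continuous; exact: is_derive_cutoff.
    have mc : measurable_fun setT (cutoff (h n)).
      exact: continuous_measurable_fun.
    exact: (measurable_funTS mc).
  - move=> x; rewrite /I /= in_itv/= => /andP[ax xb].
    apply: cvg_near_cst.
    have := hlt ((x - a) / 2) ltac:(lra).
    have := hlt ((b - x) / 2) ltac:(lra).
    apply: filterS2 => n h1 h2.
    by rewrite cutoff_eq1 ?mulr1//; lra.
  - exact: integrable_norm.
  - by move=> n x _; rewrite normrM ler_piMr// cutoff_le1.
have E n : (\int[lebesgue_measure]_(x in I) (G x * dcutoff (h n) x))%R =
    - (\int[lebesgue_measure]_(x in I) (H x * cutoff (h n) x))%R.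
  rewrite -(GH (cutoff_test (h0 n) (hab n))); apply: eq_Rintegral => x _.
  by rewrite derive1E; case: (is_derive_cutoff (h n) x) => _ ->.
have cvG : (\int[lebesgue_measure]_(x in I) (G x * dcutoff (h n) x))%R
    @[n --> \oo] --> G a - G b.
  have [_ Ga Gb] := (continuous_within_itvP G ab).1 cG.
  apply/cvgrPdist_le => e e0; have e2 : 0 < e / 2 by rewrite divr_gt0.
  move/cvgrPdist_le : Ga => /(_ _ e2) /nbhs_ballP[d1 /= d10 Ga].
  move/cvgrPdist_le : Gb => /(_ _ e2) /nbhs_ballP[d2 /= d20 Gb].
  have := hlt (d1 / 2) ltac:(by rewrite divr_gt0).
  have := hlt (d2 / 2) ltac:(by rewrite divr_gt0).
  apply: filterS2 => n h2 h1.
  rewrite [leRHS](_ : e = e / 2 + e / 2); last by lra.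
  apply: dcutoff_average => //.
  - move=> x /andP[ax xa]; apply: Ga => //; rewrite /ball /= ltr_norml.
    by apply/andP; split; lra.
  - move=> x /andP[ax xa]; apply: Gb => //; rewrite /ball /= ltr_norml.
    by apply/andP; split; lra.
have cvG' : (\int[lebesgue_measure]_(x in I) (G x * dcutoff (h n) x))%R
    @[n --> \oo] --> - (\int[lebesgue_measure]_(x in I) H x)%R.
  by under eq_fun do rewrite E; exact: cvgN.
have -> : (\int[lebesgue_measure]_(x in I) H x)%R =
    - - (\int[lebesgue_measure]_(x in I) H x)%R by rewrite opprK.
by rewrite -(cvg_unique _ cvG cvG')// opprB.
Qed.

End weak_ftc.

Lemma weak_ftc (R : realType) (a b : R) (G H : R -> R) : a < b ->
  {within `[a, b], continuous G} ->
  lebesgue_measure.-integrable `]a, b[ (EFin \o H) ->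
  weak_der `]a, b[%classic G H ->
  (\int[lebesgue_measure]_(x in `]a, b[) H x)%R = G b - G a.
Proof.
move=> ab cG iH GH; have [S [s [dS cs [s0 Sneg Sge S01 sn0]]]] := smooth_step R.
exact: (@weak_ftc_cutoff R a b ab S s).
Qed.

(** * Green's second identity *)
Lemma integrable_sqint_continuous (R : realType) (a b : R) (p w : R -> R) :
  sqint lebesgue_measure `]a, b[%classic p -> continuous w ->
  lebesgue_measure.-integrable `]a, b[ (EFin \o (fun x => p x * w x)).
Proof.
by move=> sp cw; apply: sqint_mul => //; exact: continuous_sqint.
Qed.

Lemma derive1_eq (R : realType) (f f' : R -> R) :
  (forall x : R, is_derive x (1 : R) f (f' x)) -> derive1 f = f'.
Proof. by move=> df; apply/funext => x; rewrite derive1E; case: (df x). Qed.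

Lemma test_function_mul (R : realType) (I : set R) (g f f' : R -> R) :
  test_function I g -> (forall x : R, is_derive x (1 : R) f (f' x)) ->
  continuous f' -> test_function I (fun x => g x * f x).
Proof.
move=> /test_functionP[g' [K [_ cK KI [dg cg' gK _]]]] df cf'.
have dgf x : is_derive x (1 : R) (fun x => g x * f x) (g' x * f x + g x * f' x).
  exact: is_derive_mul.
have cf := is_derive_continuous df; have cg := is_derive_continuous dg.
split.
- by move=> x; case: (dgf x).
- rewrite (derive1_eq dgf) => x; apply: cvgD.
    by apply: cvgM; [exact: cg'|exact: cf].
  by apply: cvgM; [exact: cg|exact: cf'].
- by exists K; split=> // x /gK ->; rewrite mul0r.
Qed.

Section wronskian.
Context (R : realType) (f f1 f2 : R -> R).
Hypotheses (df : forall x : R, is_derive x (1 : R) f (f1 x))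
  (df1 : forall x : R, is_derive x (1 : R) f1 (f2 x)) (cf2 : continuous f2).

Let cf := is_derive_continuous df.
Let cf1 := is_derive_continuous df1.

(* Test p0' = p1 against g f1 and p1' = q1 against g f, and subtract: the terms
   p1 g f1 cancel. *)
Lemma wronskian_weak (a b : R) (p0 p1 q1 : R -> R) :
  sqint lebesgue_measure `]a, b[%classic p0 ->
  sqint lebesgue_measure `]a, b[%classic p1 ->
  sqint lebesgue_measure `]a, b[%classic q1 ->
  weak_der `]a, b[%classic p0 p1 -> weak_der `]a, b[%classic p1 q1 ->
  weak_der `]a, b[%classic (fun x => p1 x * f x - p0 x * f1 x)
                           (fun x => q1 x * f x - p0 x * f2 x).
Proof.
move=> s0 s1 sq w0 w1 g tg.
have [g' [K [gE cK KI [dg cg' gK _]]]] := test_functionP tg.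
have cg := is_derive_continuous dg.
have cM (u v : R -> R) : continuous u -> continuous v ->
    continuous (fun x => u x * v x).
  by move=> cu cv x; apply: cvgM; [exact: cu|exact: cv].
have dgf x : is_derive x (1 : R) (fun x => g x * f x) (g' x * f x + g x * f1 x).
  exact: is_derive_mul.
have dgf1 x : is_derive x (1 : R) (fun x => g x * f1 x)
    (g' x * f1 x + g x * f2 x).
  exact: is_derive_mul.
have i1 := integrable_sqint_continuous s1 (cM _ _ cg' cf).
have i2 := integrable_sqint_continuous s1 (cM _ _ cg cf1).
have i3 := integrable_sqint_continuous s0 (cM _ _ cg' cf1).
have i4 := integrable_sqint_continuous s0 (cM _ _ cg cf2).
have i5 := integrable_sqint_continuous sq (cM _ _ cg cf).
have mI : @measurable _ (measurableTypeR R) `]a, b[%classic.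
  exact: measurable_itv.
have := w1 _ (test_function_mul tg df cf1); rewrite (derive1_eq dgf).
under eq_Rintegral do rewrite mulrDr.
rewrite (RintegralD mI i1 i2) => E1.
have := w0 _ (test_function_mul tg df1 cf2); rewrite (derive1_eq dgf1).
under eq_Rintegral do rewrite mulrDr.
rewrite (RintegralD mI i3 i4) => E2.
rewrite -gE.
have E3 x : (p1 x * f x - p0 x * f1 x) * g' x =
    p1 x * (g' x * f x) - p0 x * (g' x * f1 x) by ring.
have E4 x : (q1 x * f x - p0 x * f2 x) * g x =
    q1 x * (g x * f x) - p0 x * (g x * f2 x) by ring.
under eq_Rintegral do rewrite E3.
under [in RHS]eq_Rintegral do rewrite E4.
rewrite (RintegralB mI i1 i3) (RintegralB mI i5 i4).
move: E1 E2; lra.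
Qed.

Lemma wronskian_ftc (a b : R) (p0 p1 q1 : R -> R) : a < b ->
  {within `[a, b], continuous p0} -> {within `[a, b], continuous p1} ->
  sqint lebesgue_measure `]a, b[%classic p0 ->
  sqint lebesgue_measure `]a, b[%classic p1 ->
  sqint lebesgue_measure `]a, b[%classic q1 ->
  weak_der `]a, b[%classic p0 p1 -> weak_der `]a, b[%classic p1 q1 ->
  (\int[lebesgue_measure]_(x in `]a, b[) (q1 x * f x - p0 x * f2 x))%R =
  (p1 b * f b - p0 b * f1 b) - (p1 a * f a - p0 a * f1 a).
Proof.
move=> ab c0 c1 s0 s1 sq w0 w1.
apply: (weak_ftc (G := fun x => p1 x * f x - p0 x * f1 x)) => //.
- move=> x; apply: cvgB; apply: cvgM.
  + exact: c1.
  + exact: (continuous_subspaceT cf).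
  + exact: c0.
  + exact: (continuous_subspaceT cf1).
- have mI : @measurable _ (measurableTypeR R) `]a, b[%classic.
    exact: measurable_itv.
  exact: (integrableB mI (integrable_sqint_continuous sq cf)
    (integrable_sqint_continuous s0 cf2)).
- exact: wronskian_weak.
Qed.

Lemma green_periodic (a b : R) (p0 p1 q1 : R -> R) : a < b ->
  {within `[a, b], continuous p0} -> {within `[a, b], continuous p1} ->
  sqint lebesgue_measure `]a, b[%classic p0 ->
  sqint lebesgue_measure `]a, b[%classic p1 ->
  sqint lebesgue_measure `]a, b[%classic q1 ->
  weak_der `]a, b[%classic p0 p1 -> weak_der `]a, b[%classic p1 q1 ->
  p0 a = p0 b -> p1 a = p1 b -> f a = f b -> f1 a = f1 b ->
  (\int[lebesgue_measure]_(x in `]a, b[) (q1 x * f x))%R =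
  (\int[lebesgue_measure]_(x in `]a, b[) (p0 x * f2 x))%R.
Proof.
move=> ab c0 c1 s0 s1 sq w0 w1 e0 e1 ef ef1.
have := wronskian_ftc ab c0 c1 s0 s1 sq w0 w1.
rewrite e0 e1 ef ef1 subrr RintegralB//; last 2 first.
- exact: integrable_sqint_continuous.
- exact: integrable_sqint_continuous.
by move/eqP; rewrite subr_eq0 => /eqP.
Qed.

Lemma integrable_small (a : R) (G : R -> R) (n : nat) :
  lebesgue_measure.-integrable `]a, +oo[ (EFin \o G) ->
  exists2 b, a + n.+1%:R <= b & `|G b| <= n.+1%:R^-1.
Proof.
move=> iG; apply: contrapT => H.
have H1 b : a + n.+1%:R <= b -> n.+1%:R^-1 < `|G b|.
  by move=> ab; rewrite ltNge; apply/negP => Gb; apply: H; exists b.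
have mJ : @measurable _ (measurableTypeR R) `[a + n.+1%:R, +oo[%classic.
  exact: measurable_itv.
have iG' : lebesgue_measure.-integrable `[a + n.+1%:R, +oo[ (EFin \o G).
  apply: integrableS iG => //; apply: subset_itvr.
  by rewrite bnd_simp ltrDl.
have ic : lebesgue_measure.-integrable `[a + n.+1%:R, +oo[
    (EFin \o cst (n.+1%:R^-1 : R)).
  apply: le_integrable iG' => //.
    by apply/measurable_EFinP; exact: measurable_cst.
  move=> x; rewrite /= in_itv/= andbT => /H1 /ltW h.
  by rewrite lee_fin (ger0_norm _).
have := integrable_lty mJ ic.
rewrite /= integral_cst//= lebesgue_measure_itv/= ltry/=.
by rewrite mulry gtr0_sg ?invr_gt0// mul1e ltxx.
Qed.

(* The Wronskian is integrable, hence small along a sequence going to infinity: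
   this kills the boundary term there. *)
Lemma green_halfline (a : R) (p0 p1 q1 : R -> R) :
  {within `[a, +oo[, continuous p0} -> {within `[a, +oo[, continuous p1} ->
  sqint lebesgue_measure `]a, +oo[%classic p0 ->
  sqint lebesgue_measure `]a, +oo[%classic p1 ->
  sqint lebesgue_measure `]a, +oo[%classic q1 ->
  sqint lebesgue_measure `]a, +oo[%classic f ->
  sqint lebesgue_measure `]a, +oo[%classic f1 ->
  sqint lebesgue_measure `]a, +oo[%classic f2 ->
  weak_der `]a, +oo[%classic p0 p1 -> weak_der `]a, +oo[%classic p1 q1 ->
  p1 a = 0 -> f1 a = 0 ->
  (\int[lebesgue_measure]_(x in `]a, +oo[) (q1 x * f x))%R =
  (\int[lebesgue_measure]_(x in `]a, +oo[) (p0 x * f2 x))%R.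
Proof.
move=> c0 c1 s0 s1 sq sf sf1 sf2 w0 w1 e1 ef1.
pose I := `]a, +oo[%classic : set R.
have mI : @measurable _ (measurableTypeR R) I by exact: measurable_itv.
pose G x := p1 x * f x - p0 x * f1 x.
pose H x := q1 x * f x - p0 x * f2 x.
have iq := sqint_mul mI sq sf; have ip := sqint_mul mI s0 sf2.
have iG : lebesgue_measure.-integrable I (EFin \o G).
  exact: (integrableB mI (sqint_mul mI s1 sf) (sqint_mul mI s0 sf1)).
have iH : lebesgue_measure.-integrable I (EFin \o H).
  exact: (integrableB mI iq ip).
have GH b : a < b -> (\int[lebesgue_measure]_(x in `]a, b[) H x)%R = G b.
  move=> ab; have JI : `]a, b[ `<=` I by exact: subset_itvl.
  have KI : `[a, b] `<=` `[a, +oo[ by exact: subset_itvl.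
  have mJ : @measurable _ (measurableTypeR R) `]a, b[%classic.
    exact: measurable_itv.
  rewrite /H (@wronskian_ftc a b p0 p1 q1 ab).
  - by rewrite e1 ef1 mul0r mulr0 subrr subr0.
  - exact: continuous_subspaceW c0.
  - exact: continuous_subspaceW c1.
  - exact: (sqint_subset mJ mI JI s0).
  - exact: (sqint_subset mJ mI JI s1).
  - exact: (sqint_subset mJ mI JI sq).
  - exact: weak_der_subset JI w0.
  - exact: weak_der_subset JI w1.
have /choice[b_ Hb] : forall n : nat, exists b, a + n.+1%:R <= b /\
    `|G b| <= n.+1%:R^-1.
  by move=> n; have [b h1 h2] := integrable_small n iG; exists b.
have ab n : a < b_ n by case: (Hb n) => h _; apply: lt_le_trans h; rewrite ltrDl.
have cv0 : G (b_ n) @[n --> \oo] --> (0 : R).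
  apply/cvgrPdist_le => e e0.
  apply: filterS (near_infty_natSinv_lt (PosNum e0)) => n /= /ltW h.
  by rewrite sub0r normrN; apply: le_trans h; case: (Hb n).
have mH : measurable_fun I H by apply/measurable_EFinP; case/integrableP: iH.
have cvH : (\int[lebesgue_measure]_(x in I) (H \_ `]a, b_ n[) x)%R
    @[n --> \oo] --> (\int[lebesgue_measure]_(x in I) H x)%R.
  apply: (@Rintegral_dominated_cvg _ _ R lebesgue_measure I
    (fun n => H \_ `]a, b_ n[) H (fun x => `|H x|)) => //.
  - move=> n.
    have mb : @measurable _ (measurableTypeR R) `]a, b_ n[%classic.
      exact: measurable_itv.
    apply/(measurable_restrict _ mb mI).
    by apply: measurable_funS mH; [exact: measurable_itv|exact: subIsetl].
  - move=> x; rewrite /I /= in_itv/= andbT => ax.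
    apply: cvg_near_cst.
    have e0 : 0 < (x - a + 1)^-1 by rewrite invr_gt0; lra.
    apply: filterS (near_infty_natSinv_lt (PosNum e0)) => n /=.
    rewrite ltf_pV2 ?posrE; [|by []|by lra].
    move=> h; rewrite patchE mem_set//= in_itv/= ax /=.
    by apply: lt_le_trans (Hb n).1; lra.
  - exact: integrable_norm.
  - move=> n x _; rewrite patchE; case: ifP => // _; rewrite normr0//.
have E n : (\int[lebesgue_measure]_(x in I) (H \_ `]a, b_ n[) x)%R = G (b_ n).
  rewrite -GH// -Rintegral_mkcondr; congr (Rintegral _ _ _).
  by apply/setIidPr; exact: subset_itvl.
have cv0' : (\int[lebesgue_measure]_(x in I) (H \_ `]a, b_ n[) x)%R
    @[n --> \oo] --> (0 : R).
  by under eq_fun do rewrite E; exact: cv0.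
have : (\int[lebesgue_measure]_(x in I) H x)%R = 0 by exact: cvg_unique cvH cv0'.
rewrite /H RintegralB// => /eqP.
by rewrite subr_eq0 => /eqP.
Qed.

End wronskian.

(** * The dnoidal profile *)
Section jacobi.
Context (R : realType) (k : R).
Hypothesis hk : 0 < k < 1.

Let Delta (theta : R) : R := 1 - k ^+ 2 * sin theta ^+ 2.

Lemma jacobi_Delta_ge (theta : R) : 1 - k ^+ 2 <= Delta theta.
Proof.
by rewrite /Delta lerD2l lerN2 ler_piMr ?sqr_ge0//.
Qed.

Lemma jacobi_modulus_gt0 : 0 < 1 - k ^+ 2.
Proof. by move: hk => /andP[k0 k1]; nra. Qed.

Lemma jacobi_Delta_gt0 (theta : R) : 0 < Delta theta.
Proof. exact: lt_le_trans jacobi_modulus_gt0 (jacobi_Delta_ge _). Qed.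

Let g (theta : R) : R := (Num.sqrt (Delta theta))^-1.

Lemma is_derive_Delta (am : R -> R) (x dam : R) :
  is_derive x (1 : R) am (dam) ->
  is_derive x (1 : R) (fun x => Delta (am x))
    (- (2 * k ^+ 2 * sin (am x) * cos (am x) * dam)).
Proof.
move=> da.
have ds : is_derive x (1 : R) (fun x => sin (am x)) (cos (am x) * dam).
  exact: (is_derive1_comp (is_derive_sin (am x)) da).
have d2 := is_derive_scale (k ^+ 2) (is_derive_mul ds ds).
have d3 := is_derive_sub (is_derive_cst (1 : R) x (1 : R)) d2.
have -> : (fun x => Delta (am x)) =
    (fun x => cst 1 x - k ^+ 2 * (sin (am x) * sin (am x))).
  by apply/funext => y; rewrite /Delta expr2.
by apply: is_derive_eq d3 _; ring.
Qed.

Lemma is_derive_sqrt_Delta (am : R -> R) (x dam : R) :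
  is_derive x (1 : R) am (dam) ->
  is_derive x (1 : R) (fun x => Num.sqrt (Delta (am x)))
    (- (k ^+ 2 * sin (am x) * cos (am x) * dam) / Num.sqrt (Delta (am x))).
Proof.
move=> /is_derive_Delta dD.
have D0 := jacobi_Delta_gt0 (am x).
have := @is_derive1_comp R Num.sqrt (fun x => Delta (am x)) x _ _
  (is_derive1_sqrt D0) dD.
move=> d; apply: is_derive_eq d _.
by field; rewrite gt_eqF// sqrtr_gt0.
Qed.

Lemma continuous_elliptic_integrand : continuous g.
Proof.
have d x : is_derive x (1 : R) (fun x => Num.sqrt (Delta x))
    (- (k ^+ 2 * sin x * cos x * 1) / Num.sqrt (Delta x)).
  exact: (@is_derive_sqrt_Delta id x 1).
move=> x; apply: (@cvgV _ _ _ _ (fun x => Num.sqrt (Delta x))).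
  by rewrite gt_eqF// sqrtr_gt0 jacobi_Delta_gt0.
exact: (is_derive_continuous d).
Qed.

Lemma elliptic_integrand_ge1 (theta : R) : 1 <= g theta.
Proof.
have D0 := jacobi_Delta_gt0 theta.
rewrite /g -[1]invr1 lef_pV2 ?posrE ?sqrtr_gt0//.
rewrite -[1 in leRHS]sqrtr1 ler_sqrt// /Delta.
by rewrite lerBlDr lerDl mulr_ge0// sqr_ge0.
Qed.

Lemma is_derive_ellipticF (x : R) : is_derive x (1 : R) (ellipticF k) (g x).
Proof.
exact: (is_derive_oriented_integral continuous_elliptic_integrand).
Qed.

Lemma ellipticF_increment (x y : R) : x < y ->
  y - x <= ellipticF k y - ellipticF k x.
Proof.
move=> xy; have [|c _ ->] := MVT xy (fun z _ => is_derive_ellipticF z).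
  by apply: continuous_subspaceT; exact: is_derive_continuous is_derive_ellipticF.
by rewrite ler_peMl ?elliptic_integrand_ge1// subr_ge0 ltW.
Qed.

Lemma ellipticF_inj : injective (ellipticF k).
Proof.
move=> x y Fxy; apply/eqP; rewrite eq_le !leNgt; apply/andP; split;
  by apply/negP => h; have := ellipticF_increment h; rewrite Fxy; lra.
Qed.

Lemma ellipticF0 : ellipticF k 0 = 0.
Proof. by rewrite /ellipticF lexx set_itv1 Rintegral_set1. Qed.

Lemma ellipticF_am (x : R) : ellipticF k (jacobi_am x k) = x.
Proof.
suff [y Fy] : exists y, ellipticF k y = x.
  exact: (@xgetPex _ 0 [set phi | ellipticF k phi = x]) (ex_intro _ y Fy).
have cF : {within `[- `|x|, `|x|], continuous (ellipticF k)}.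
  by apply: continuous_subspaceT; exact: is_derive_continuous is_derive_ellipticF.
have [->|x0] := eqVneq x 0; first by exists 0; exact: ellipticF0.
have nx : 0 < `|x| by rewrite normr_gt0.
have h1 : `|x| <= ellipticF k `|x|.
  by have := ellipticF_increment nx; rewrite ellipticF0 !subr0.
have h2 : ellipticF k (- `|x|) <= - `|x|.
  have nx' : - `|x| < 0 by rewrite oppr_lt0.
  by have := ellipticF_increment nx'; rewrite ellipticF0; lra.
have hle : - `|x| <= `|x| by lra.
have [|y _ Fy] := @IVT _ (ellipticF k) _ _ x hle cF; last by exists y.
rewrite ge_min le_max (le_trans h2) ?(le_trans _ h1) ?orbT// ?ler_norm//.
by have := ler_norm (- x); rewrite normrN; lra.
Qed.

Lemma am_ellipticF (y : R) : jacobi_am (ellipticF k y) k = y.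
Proof. by apply: ellipticF_inj; rewrite ellipticF_am. Qed.

Lemma is_derive_am (x : R) :
  is_derive x (1 : R) (fun x => jacobi_am x k) (jacobi_dn x k).
Proof.
rewrite -{1}(ellipticF_am x).
rewrite [X in is_derive _ _ _ X](_ : _ = (g (jacobi_am x k))^-1); last first.
  by rewrite /g invrK.
apply: is_derive_inverse.
- by near=> y; exact: am_ellipticF.
- by near=> y; exact: (is_derive_continuous is_derive_ellipticF).
- exact: is_derive_ellipticF.
- by rewrite gt_eqF//; exact: lt_le_trans (elliptic_integrand_ge1 _).
Unshelve. all: by end_near. Qed.

Let sn x := sin (jacobi_am x k).
Let cn x := cos (jacobi_am x k).

Lemma jacobi_dn_gt0 (x : R) : 0 < jacobi_dn x k.
Proof. by rewrite sqrtr_gt0 jacobi_Delta_gt0. Qed.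

Lemma jacobi_dn_ge (x : R) : Num.sqrt (1 - k ^+ 2) <= jacobi_dn x k.
Proof. by rewrite ler_wsqrtr// jacobi_Delta_ge. Qed.

Lemma jacobi_dn_sqr (x : R) : jacobi_dn x k ^+ 2 = 1 - k ^+ 2 * sn x ^+ 2.
Proof. by rewrite sqr_sqrtr// ltW// jacobi_Delta_gt0. Qed.

Definition jacobi_dn1 (x : R) : R := - (k ^+ 2) * (sn x * cn x).

Lemma is_derive_jacobi_dn (x : R) :
  is_derive x (1 : R) (fun x => jacobi_dn x k) (jacobi_dn1 x).
Proof.
have := is_derive_sqrt_Delta (is_derive_am x).
move=> d; apply: is_derive_eq d _.
rewrite -/(jacobi_dn x k) /jacobi_dn1 -/(sn x) -/(cn x).
by field; rewrite gt_eqF// jacobi_dn_gt0.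
Qed.

Lemma is_derive_jacobi_dn1 (x : R) : is_derive x (1 : R) jacobi_dn1
  ((2 - k ^+ 2) * jacobi_dn x k - 2 * jacobi_dn x k ^+ 3).
Proof.
have ds : is_derive x (1 : R) sn (cn x * jacobi_dn x k).
  exact: (is_derive1_comp (is_derive_sin _) (is_derive_am x)).
have dc : is_derive x (1 : R) cn (- sn x * jacobi_dn x k).
  exact: (is_derive1_comp (is_derive_cos _) (is_derive_am x)).
have := is_derive_scale (- (k ^+ 2)) (is_derive_mul ds dc).
move=> d; apply: is_derive_eq d _.
have -> : jacobi_dn x k ^+ 3 = jacobi_dn x k ^+ 2 * jacobi_dn x k by rewrite exprSr.
rewrite jacobi_dn_sqr; have := cos2Dsin2 (jacobi_am x k).
rewrite -/(sn x) -/(cn x) => h.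
have -> : cn x * jacobi_dn x k * cn x = cn x ^+ 2 * jacobi_dn x k by ring.
by rewrite (_ : cn x ^+ 2 = 1 - sn x ^+ 2); [ring|lra].
Qed.

End jacobi.

Lemma is_derive_comp_scale (R : realType) (f : R -> R) (c x a : R) :
  is_derive (c * x) 1 f a -> is_derive x 1 (fun y => f (c * y)) (c * a).
Proof.
move=> fa; rewrite (_ : (fun y => _) = (fun y => f (c * y + 0))).
  by apply: is_derive_comp_affine; rewrite addr0.
by apply/funext => y; rewrite addr0.
Qed.

Lemma dnoidal_ode (R : realType) (eta1 k omega : R) : 0 < k < 1 ->
  eta1 ^+ 2 * (2 - k ^+ 2) = 2 * omega ->
  exists f1 : R -> R,
    (forall x : R, is_derive x (1 : R) (dnoidal eta1 k) (f1 x)) /\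
    (forall x : R, is_derive x (1 : R) f1
      (omega * dnoidal eta1 k x - dnoidal eta1 k x ^+ 3)).
Proof.
move=> hk hom; pose c := eta1 / Num.sqrt 2.
have c2 : c ^+ 2 = eta1 ^+ 2 / 2 by rewrite expr_div_n sqr_sqrtr.
exists (fun x => eta1 * (c * jacobi_dn1 k (c * x))); split=> x.
  apply: is_derive_scale.
  apply: (is_derive_comp_scale (f := fun x => jacobi_dn x k)).
  exact: is_derive_jacobi_dn.
have := is_derive_scale eta1 (is_derive_scale c (is_derive_comp_scale
  (is_derive_jacobi_dn1 hk (c * x)))).
move=> d'; apply: is_derive_eq d' _; rewrite /dnoidal -/c; set d := jacobi_dn _ _.
have -> : omega = eta1 ^+ 2 * (2 - k ^+ 2) / 2 by rewrite hom; field.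
have -> : c * (c * ((2 - k ^+ 2) * d - 2 * d ^+ 3)) =
  c ^+ 2 * ((2 - k ^+ 2) * d - 2 * d ^+ 3) by ring.
by rewrite c2; field.
Qed.

Lemma periodic_derive (R : realType) (f f1 : R -> R) (T : R) :
  (forall x : R, is_derive x (1 : R) f (f1 x)) -> periodic f T -> periodic f1 T.
Proof.
move=> df pf x; have d1 : is_derive x (1 : R) (fun y => f (1 * y + T)) (1 * f1 (x + T)).
  by apply: is_derive_comp_affine; rewrite mul1r; exact: df.
have e : (fun y => f (1 * y + T)) = f by apply/funext => y; rewrite mul1r pf.
by rewrite e mul1r in d1; case: (df x) => _ <-; case: d1.
Qed.

(** * The soliton profile *)
Lemma sqint_exp (R : realType) (a L : R) : 0 < a ->
  sqint lebesgue_measure `]L, +oo[%classic (fun x => expR (- (a * (x - L)))).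
Proof.
move=> a0; pose c := 2 * a; have c0 : 0 < c by rewrite mulr_gt0.
have de (r b x : R) : is_derive x (1 : R) (fun x : R => expR (r * x + b))
    (r * expR (r * x + b)).
  by apply: is_derive_comp_affine; exact: is_derive_expR.
have eE : (fun x => expR (- (a * (x - L)))) = (fun x => expR (- a * x + a * L)).
  by apply/funext => x; congr expR; ring.
rewrite eE; split.
  have mf : measurable_fun setT (fun x : R => expR (- a * x + a * L)).
    by apply: continuous_measurable_fun; exact: is_derive_continuous (de _ _).
  exact: (measurable_funTS mf).
rewrite (_ : (fun x => _) = EFin \o (fun x => expR (- c * x + c * L))); last first.
  apply/funext => x /=; rewrite -expRM_natl; congr (expR _)%:E.
  by rewrite /c; ring.
have cf : continuous (fun x : R => expR (- c * x + c * L)).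
  exact: is_derive_continuous (de _ _).
have mL : @measurable _ (measurableTypeR R) `[L, +oo[%classic.
  exact: measurable_itv.
suff : lebesgue_measure.-integrable `[L, +oo[
    (EFin \o (fun x => expR (- c * x + c * L))).
  by apply: integrableS => //; apply: subset_itvr; rewrite bnd_simp.
apply/integrableP; split.
  apply/measurable_EFinP.
  have mf : measurable_fun setT (fun x : R => expR (- c * x + c * L)).
    exact: continuous_measurable_fun.
  exact: (measurable_funTS mf).
pose F (x : R) := - c^-1 * expR (- c * x + c * L).
have dF x : is_derive x (1 : R) F (expR (- c * x + c * L)).
  have := is_derive_scale (- c^-1) (de (- c) (c * L) x) => d.
  by apply: is_derive_eq d _; rewrite mulrA mulrNN mulVf ?mul1r// gt_eqF.
have cF := is_derive_continuous dF.
rewrite (@eq_integral _ (measurableTypeR R) R lebesgue_measure _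
  (fun x : R => (expR (- c * x + c * L))%:E)); last first.
  by move=> x _; rewrite gee0_abs// lee_fin expR_ge0.
rewrite (@ge0_continuous_FTC2y _ _ F L 0) ?ltry//.
- exact: continuous_subspaceT.
- rewrite (_ : F = (fun x => (- c^-1 * expR (c * L)) * expR (- (c * x)))); last first.
    by apply/funext => x; rewrite /F (mulNr c) expRD; ring.
  rewrite -(mulr0 (- c^-1 * expR (c * L))); apply: cvgMl_tmp.
  apply: (@cvg_comp _ _ _ (fun x => c * x) (fun z => expR (- z))); last first.
    exact: cvgr_expR.
  exact: gt0_cvgMry.
- exact: (cvg_at_right_filter (cF L)).
- by move=> x _; rewrite derive1E; case: (dF x).
Qed.

Section sech.
Context (R : realType).

Definition tanhyp (z : R) : R := (expR z - expR (- z)) / (expR z + expR (- z)).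

Let den_gt0 (z : R) : 0 < expR z + expR (- z).
Proof. by rewrite addr_gt0 ?expR_gt0. Qed.

Lemma sech_gt0 (z : R) : 0 < sech z.
Proof. by rewrite divr_gt0. Qed.

Lemma sech_tanhyp_sqr (z : R) : sech z ^+ 2 + tanhyp z ^+ 2 = 1.
Proof.
have h : expR z * expR (- z) = 1 by rewrite expRN divff// gt_eqF ?expR_gt0.
rewrite /sech /tanhyp !expr_div_n -mulrDl.
rewrite (_ : 2 ^+ 2 + _ = (expR z + expR (- z)) ^+ 2); last first.
  rewrite (_ : 2 ^+ 2 = 4 * (expR z * expR (- z))); first by ring.
  by rewrite h mulr1 expr2 -natrM.
by rewrite divff// gt_eqF// exprn_gt0.
Qed.

Let is_derive_expN (z : R) : is_derive z (1 : R) (fun z => expR (- z)) (- expR (- z)).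
Proof.
have := @is_derive_comp_affine R expR (-1) 0 z _ (is_derive_expR _).
rewrite (_ : (fun y => _) = (fun z => expR (- z))); last first.
  by apply/funext => y; rewrite mulN1r addr0.
by rewrite mulN1r addr0 mulN1r.
Qed.

Let is_derive_den (z : R) :
  is_derive z (1 : R) (fun z => expR z + expR (- z)) (expR z - expR (- z)).
Proof. exact: is_derive_add. Qed.

Let is_derive_deninv (z : R) : is_derive z (1 : R)
  (fun z => (expR z + expR (- z))^-1)
  (- (expR z - expR (- z)) / (expR z + expR (- z)) ^+ 2).
Proof.
have d0 : expR z + expR (- z) != 0 by rewrite gt_eqF.
have := @is_deriveV _ (fun z => expR z + expR (- z)) z _ _ d0 (is_derive_den z).
move=> d; apply: is_derive_eq d _.
by rewrite /GRing.scale /= mulNr mulrC mulNr.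
Qed.

Lemma is_derive_sech (z : R) :
  is_derive z (1 : R) (@sech R) (- (sech z * tanhyp z)).
Proof.
have := is_derive_scale 2 (is_derive_deninv z) => d.
apply: is_derive_eq d _; rewrite /sech /tanhyp.
by field; rewrite gt_eqF.
Qed.

Lemma is_derive_tanhyp (z : R) : is_derive z (1 : R) tanhyp (sech z ^+ 2).
Proof.
have dn := is_derive_sub (is_derive_expR z) (is_derive_expN z).
have d := is_derive_mul dn (is_derive_deninv z).
apply: is_derive_eq d _; rewrite -[RHS](addrK (tanhyp z ^+ 2)) sech_tanhyp_sqr.
by rewrite /tanhyp; field; rewrite gt_eqF.
Qed.

Lemma is_derive_sech_tanhyp (z : R) : is_derive z (1 : R)
  (fun z => - (sech z * tanhyp z)) (sech z - 2 * sech z ^+ 3).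
Proof.
have d := is_derive_mul (is_derive_sech z) (is_derive_tanhyp z).
have := is_derive_scale (-1) d; rewrite (_ : (fun y => _) =
  (fun z => - (sech z * tanhyp z))) => [d'|]; last first.
  by apply/funext => y; rewrite mulN1r.
apply: is_derive_eq d' _.
rewrite -[in RHS](mulr1 (sech z)) -{2}(sech_tanhyp_sqr z).
by rewrite !exprS expr0; ring.
Qed.

Lemma tanhyp_norm_le1 (z : R) : `|tanhyp z| <= 1.
Proof.
rewrite -(@ler_pXn2r _ 2)// ?nnegrE// -normrX ger0_norm ?sqr_ge0//.
by rewrite expr1n -(sech_tanhyp_sqr z) lerDr sqr_ge0.
Qed.

Lemma sech_le_exp (z : R) : sech z <= 2 * expR (- z).
Proof.
rewrite /sech ler_wpM2l// expRN lef_pV2 ?posrE ?addr_gt0 ?invr_gt0 ?expR_gt0//.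
by rewrite lerDl invr_ge0 expR_ge0.
Qed.

Lemma sech_tanhyp0 : sech (0 : R) * tanhyp 0 = 0.
Proof. by rewrite /tanhyp oppr0 subrr mul0r mulr0. Qed.

End sech.

Section soliton.
Context (R : realType) (L : R).

Definition soliton (b x : R) : R := Num.sqrt 2 * b * sech (b * (x - L)).

Definition soliton1 (b x : R) : R :=
  Num.sqrt 2 * b * (b * - (sech (b * (x - L)) * tanhyp (b * (x - L)))).

Lemma half_soliton_soliton (omega x : R) : 0 < omega ->
  half_soliton L omega x = soliton (Num.sqrt omega) x.
Proof. by move=> o0; rewrite /half_soliton sqrtrM. Qed.

Let is_derive_shift (f : R -> R) (b x a : R) :
  is_derive (b * (x - L)) 1 f a -> is_derive x 1 (fun x => f (b * (x - L))) (b * a).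
Proof.
have e y : b * (y - L) = b * y + - (b * L) by ring.
rewrite e => fa; rewrite (_ : (fun x => _) = (fun y => f (b * y + - (b * L)))).
  exact: is_derive_comp_affine.
by apply/funext => y; rewrite e.
Qed.

Lemma is_derive_soliton (b x : R) :
  is_derive x (1 : R) (soliton b) (soliton1 b x).
Proof.
apply: is_derive_scale; apply: is_derive_shift; exact: is_derive_sech.
Qed.

Lemma is_derive_soliton1 (b x : R) : is_derive x (1 : R) (soliton1 b)
  (b ^+ 2 * soliton b x - soliton b x ^+ 3).
Proof.
have := is_derive_scale (Num.sqrt 2 * b) (is_derive_scale b
  (is_derive_shift (is_derive_sech_tanhyp (b * (x - L))))) => d.
apply: is_derive_eq d _; rewrite /soliton; set s := sech _.
have h : Num.sqrt 2 ^+ 2 = 2 :> R by rewrite sqr_sqrtr.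
have -> : (Num.sqrt 2 * b * s) ^+ 3 = Num.sqrt 2 ^+ 2 * (Num.sqrt 2 * b ^+ 3 * s ^+ 3).
  by ring.
by rewrite h; ring.
Qed.

Lemma soliton1_0 (b : R) : soliton1 b L = 0.
Proof. by rewrite /soliton1 subrr mulr0 sech_tanhyp0 oppr0 !mulr0. Qed.

Lemma soliton_gt0 (b x : R) : 0 < b -> 0 < soliton b x.
Proof.
move=> b0; apply: mulr_gt0; last exact: sech_gt0.
by apply: mulr_gt0 => //; rewrite sqrtr_gt0.
Qed.

Lemma soliton_le (a b x : R) : 0 < a -> a <= b <= 2 * a -> L <= x ->
  `|soliton b x| <= Num.sqrt 2 * (4 * a) * expR (- (a * (x - L))) /\
  `|soliton1 b x| <= Num.sqrt 2 * (8 * a ^+ 2) * expR (- (a * (x - L))).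
Proof.
move=> a0 /andP[ab b2] Lx; have b0 := lt_le_trans a0 ab.
have s2 : 0 < Num.sqrt 2 :> R by rewrite sqrtr_gt0.
set e := expR _; have e0 : 0 < e by exact: expR_gt0.
have he : sech (b * (x - L)) <= 2 * e.
  apply: le_trans (sech_le_exp _) _; rewrite ler_wpM2l// ler_expR lerN2.
  by rewrite ler_wpM2r// subr_ge0.
have se0 := sech_gt0 (b * (x - L)).
have t1 := tanhyp_norm_le1 (b * (x - L)).
split.
  rewrite /soliton 2!normrM (gtr0_norm s2) (gtr0_norm b0) (gtr0_norm se0) -!mulrA.
  rewrite ler_wpM2l ?(ltW s2)//.
  have : b * sech (b * (x - L)) <= 2 * a * (2 * e) by apply: ler_pM => //; exact: ltW.
  by lra.
have -> : `|soliton1 b x| = Num.sqrt 2 *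
    (b * b * (sech (b * (x - L)) * `|tanhyp (b * (x - L))|)).
  rewrite /soliton1 mulrN mulrN normrN 4!normrM (gtr0_norm s2) (gtr0_norm b0).
  by rewrite (gtr0_norm se0); ring.
rewrite -[leRHS]mulrA ler_wpM2l ?(ltW s2)//.
set s := sech _ in he se0 *; set t := `|tanhyp _| in t1 *.
have h1 : s * t <= 2 * e by apply: le_trans (ler_piMr (ltW se0) t1) he.
have st0 : 0 <= s * t by rewrite mulr_ge0 ?(ltW se0)// normr_ge0.
have h2 : b * b <= 4 * a ^+ 2 by nra.
have h3 : b * b * (s * t) <= 4 * a ^+ 2 * (2 * e).
  by apply: ler_pM => //; rewrite mulr_ge0// ltW.
apply: le_trans h3 _.
by rewrite (_ : 4 * a ^+ 2 * (2 * e) = 8 * a ^+ 2 * e)//; ring.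
Qed.

Lemma soliton_C1L2 (b : R) : 0 < b ->
  C1L2 `]L, +oo[%classic (soliton b) (soliton1 b).
Proof.
move=> b0; have mI : @measurable _ (measurableTypeR R) `]L, +oo[%classic.
  exact: measurable_itv.
have bb : b <= b <= 2 * b by rewrite lexx; lra.
have c1 : continuous (soliton1 b).
  exact: is_derive_continuous (is_derive_soliton1 b).
have c0 : continuous (soliton b).
  exact: is_derive_continuous (is_derive_soliton b).
have mc (f : R -> R) : continuous f ->
    @measurable_fun _ _ (measurableTypeR R) _ `]L, +oo[%classic f.
  move=> cf; have mf : measurable_fun setT f by exact: continuous_measurable_fun.
  exact: (measurable_funTS mf).
split; [by move=> x; exact: is_derive_soliton|exact: c1| |].
- apply: sqint_le (sqint_scale (Num.sqrt 2 * (4 * b)) mI (sqint_exp L b0)) => //.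
    exact: mc.
  move=> x; rewrite /= in_itv/= andbT => /ltW Lx; rewrite [leRHS]ger0_norm.
    by case: (soliton_le b0 bb Lx).
  by rewrite !mulr_ge0 ?expR_ge0 ?sqrtr_ge0 ?(ltW b0).
- apply: sqint_le (sqint_scale (Num.sqrt 2 * (8 * b ^+ 2)) mI (sqint_exp L b0)) => //.
    exact: mc.
  move=> x; rewrite /= in_itv/= andbT => /ltW Lx; rewrite [leRHS]ger0_norm.
    by case: (soliton_le b0 bb Lx).
  by rewrite !mulr_ge0 ?expR_ge0 ?sqrtr_ge0 ?sqr_ge0 ?(ltW b0).
Qed.

Lemma soliton_cvg (a x : R) :
  (soliton b x @[b --> a] --> soliton a x) /\
  (soliton1 b x @[b --> a] --> soliton1 a x).
Proof.
have cs : continuous (fun b : R => sech (b * (x - L))).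
  move=> b; rewrite (_ : (fun b => _) = (fun b : R => sech ((x - L) * b))); last first.
    by apply/funext => y; rewrite mulrC.
  apply: (is_derive_continuous (df := fun b : R => (x - L) *
    - (sech ((x - L) * b) * tanhyp ((x - L) * b)))) => y.
  apply: is_derive_comp_scale; exact: is_derive_sech.
have ct : continuous (fun b : R => tanhyp (b * (x - L))).
  move=> b; rewrite (_ : (fun b => _) = (fun b : R => tanhyp ((x - L) * b))); last first.
    by apply/funext => y; rewrite mulrC.
  apply: (is_derive_continuous (df := fun b : R => (x - L) *
    (sech ((x - L) * b) ^+ 2))) => y.
  apply: is_derive_comp_scale; exact: is_derive_tanhyp.
have c1 : (Num.sqrt 2 * b : R) @[b --> a] --> Num.sqrt 2 * a.
  by apply: cvgM; [exact: cvg_cst|exact: cvg_id].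
split; first by apply: cvgM => //; exact: cs.
apply: cvgM => //; apply: cvgM; first exact: cvg_id.
by apply: cvgN; apply: cvgM; [exact: cs|exact: ct].
Qed.

Lemma soliton_H1_cvg (a : R) (b_ : nat -> R) : 0 < a ->
  (forall n, a <= b_ n <= 2 * a) -> b_ n @[n --> \oo] --> a ->
  ((\int[lebesgue_measure]_(x in `]L, +oo[) (soliton (b_ n) x - soliton a x) ^+ 2)%R
   + (\int[lebesgue_measure]_(x in `]L, +oo[)
        (soliton1 (b_ n) x - soliton1 a x) ^+ 2)%R) @[n --> \oo] --> (0 : R).
Proof.
move=> a0 hb ba; have mI : @measurable _ (measurableTypeR R) `]L, +oo[%classic.
  exact: measurable_itv.
have aa : a <= a <= 2 * a by rewrite lexx; lra.
have main (f : R -> R -> R) (C : R) :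
    (forall b, 0 < b -> sqint lebesgue_measure `]L, +oo[%classic (f b)) ->
    (forall b x, a <= b <= 2 * a -> L <= x ->
       `|f b x| <= C * expR (- (a * (x - L)))) ->
    (forall x, f b x @[b --> a] --> f a x) ->
    (\int[lebesgue_measure]_(x in `]L, +oo[) (f (b_ n) x - f a x) ^+ 2)%R
      @[n --> \oo] --> (0 : R).
  move=> sf fC cf.
  have -> : (0 : R) = (\int[lebesgue_measure]_(x in `]L, +oo[) 0)%R.
    by rewrite Rintegral_cst ?mul0r.
  have [_ ig] := sqint_scale (2 * C) mI (sqint_exp L a0).
  apply: (@Rintegral_dominated_cvg _ _ R lebesgue_measure `]L, +oo[%classic
    (fun n x => (f (b_ n) x - f a x) ^+ 2) (fun=> 0)
    (fun x => (2 * C * expR (- (a * (x - L)))) ^+ 2)) => //.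
  - move=> n; have bn : 0 < b_ n by case/andP: (hb n) => h _; exact: lt_le_trans h.
    have [m _] := sqint_sub mI (sf _ bn) (sf _ a0).
    exact: measurable_funX.
  - move=> x _; have h : f (b_ n) x @[n --> \oo] --> f a x.
      exact: (cvg_comp _ _ ba (cf x)).
    have {}h : (f (b_ n) x - f a x) @[n --> \oo] --> (0 : R).
      by rewrite -(subrr (f a x)); apply: cvgB; [exact: h|exact: cvg_cst].
    by rewrite -(mul0r (0 : R)); under eq_fun do rewrite expr2; exact: cvgM.
  - move=> n x; rewrite /= in_itv/= andbT => /ltW Lx.
    have h1 := fC _ _ (hb n) Lx; have h2 := fC _ _ aa Lx.
    rewrite normrX lerXn2r ?nnegrE//.
      by have := normr_ge0 (f a x); lra.
    by apply: le_trans (ler_normB _ _) _; lra.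
rewrite -(addr0 (0 : R)); apply: cvgD.
- apply: (main _ (Num.sqrt 2 * (4 * a))).
  + by move=> b /soliton_C1L2[].
  + by move=> b x hab Lx; case: (soliton_le a0 hab Lx).
  + by move=> x; case: (soliton_cvg a x).
- apply: (main _ (Num.sqrt 2 * (8 * a ^+ 2))).
  + by move=> b /soliton_C1L2[].
  + by move=> b x hab Lx; case: (soliton_le a0 hab Lx).
  + by move=> x; case: (soliton_cvg a x).
Qed.

End soliton.

(** * Standing waves on one edge *)
Lemma subset_closure_oo (R : realType) (a b : R) : a < b ->
  `[a, b]%classic `<=` closure `]a, b[%classic.
Proof.
move=> ab x; rewrite /= in_itv/= => /andP[ax xb] U /nbhs_ballP[e /= e0 eU].
pose s := Num.min 1 (e / (b - a)) / 2.
have ba : 0 < b - a by rewrite subr_gt0.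
have m0 : 0 < Num.min 1 (e / (b - a)) by rewrite lt_min ltr01 divr_gt0.
have m1 : Num.min 1 (e / (b - a)) <= 1 by rewrite ge_min lexx.
have m2 : Num.min 1 (e / (b - a)) * (b - a) <= e.
  by rewrite -ler_pdivlMr// ge_min lexx orbT.
have s0 : 0 < s by rewrite divr_gt0.
have s1 : s < 1 by rewrite /s; lra.
have s2 : s * (b - a) < e by rewrite /s mulrAC; lra.
exists (x + s * ((a + b) / 2 - x)); split.
  by rewrite /= in_itv/=; apply/andP; split; nra.
by apply: eU; rewrite /ball /= ltr_norml; apply/andP; split; nra.
Qed.

Lemma subset_closure_oy (R : realType) (a : R) :
  `[a, +oo[%classic `<=` closure `]a, +oo[%classic.
Proof.
have -> : `]a, +oo[%classic = [set x | a < x].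
  by apply/seteqP; split=> x /=; rewrite in_itv/= andbT.
by rewrite closure_gt => x /=; rewrite in_itv/= andbT.
Qed.

Lemma H1funP (R : realType) (I : set R) (u : H1fun I) :
  [/\ {within closure I, continuous (fun x => complex.Re (u x))},
      {within closure I, continuous (fun x => complex.Im (u x))},
      L2 I u, L2 I (h1_der u) & weak_derivative I u (h1_der u)].
Proof. by case: u. Qed.

Lemma H2funP (R : realType) (I : set R) (v : H2fun I) :
  h1_der v = h1_fun (h2_der v).
Proof. by case: v. Qed.

Lemma is_CderiveD (R : realType) (F G : R -> R[i]) (t : R) (d e : R[i]) :
  is_Cderive F t d -> is_Cderive G t e ->
  is_Cderive (fun s => F s + G s) t (d + e).
Proof.
move=> [Fr Fi] [Gr Gi]; split.
- have dr := is_derive_add Fr Gr.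
  have -> : complex.Re (d + e) = complex.Re d + complex.Re e by case: d e {Fr Fi Gr Gi dr} => ? ? [? ?].
  rewrite (_ : (fun s => _) = (fun s => complex.Re (F s) + complex.Re (G s)))//.
  by apply/funext => s; case: (F s) (G s) => ? ? [? ?].
- have di := is_derive_add Fi Gi.
  have -> : complex.Im (d + e) = complex.Im d + complex.Im e by case: d e {Fr Fi Gr Gi di} => ? ? [? ?].
  rewrite (_ : (fun s => _) = (fun s => complex.Im (F s) + complex.Im (G s)))//.
  by apply/funext => s; case: (F s) (G s) => ? ? [? ?].
Qed.

Lemma is_Cderive_sum (R : realType) (I : Type) (r : seq I)
    (F : I -> R -> R[i]) (t : R) (d : I -> R[i]) :
  (forall i, is_Cderive (F i) t (d i)) ->
  is_Cderive (fun s => \sum_(i <- r) F i s) t (\sum_(i <- r) d i).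
Proof.
move=> Fd; elim: r => [|i r IH].
  rewrite big_nil (_ : (fun s => _) = cst 0); last first.
    by apply/funext => s; rewrite big_nil.
  by split; exact: is_derive_cst.
rewrite big_cons (_ : (fun s => _) = (fun s => F i s + \sum_(j <- r) F j s)).
  exact: is_CderiveD.
by apply/funext => s; rewrite big_cons.
Qed.

Lemma is_Cderive_cexpi (R : realType) (c : R[i]) (w t : R) (K : R[i]) :
  is_Cderive (fun s => c * cexpi (w * s) * K) t
             (c * ('i%C * w%:C%C * cexpi (w * t)) * K).
Proof.
have dc : is_derive t (1 : R) (fun s => cos (w * s)) (w * - sin (w * t)).
  by apply: is_derive_comp_scale; exact: is_derive_cos.
have ds : is_derive t (1 : R) (fun s => sin (w * s)) (w * cos (w * t)).
  by apply: is_derive_comp_scale; exact: is_derive_sin.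
case: c K => a b [p q]; split.
- have d := is_derive_add (is_derive_scale (a * p - b * q) dc)
    (is_derive_scale (- (b * p + a * q)) ds).
  rewrite (_ : (fun s => _) = (fun s => (a * p - b * q) * cos (w * s) +
    (- (b * p + a * q)) * sin (w * s))).
    by apply: is_derive_eq d _; rewrite /=; ring.
  by apply/funext => s /=; ring.
- have d := is_derive_add (is_derive_scale (a * q + b * p) dc)
    (is_derive_scale (a * p - b * q) ds).
  rewrite (_ : (fun s => _) = (fun s => (a * q + b * p) * cos (w * s) +
    (a * p - b * q) * sin (w * s))).
    by apply: is_derive_eq d _; rewrite /=; ring.
  by apply/funext => s /=; ring.
Qed.

(* The integral of h times the complex conjugate of v, for real h. *)
Definition pairing (R : realType) (D : set R) (h : R -> R) (v : R -> R[i]) : R[i] :=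
  ((\int[lebesgue_measure]_(x in D) (h x * complex.Re (v x)))%R
   +i* - (\int[lebesgue_measure]_(x in D) (h x * complex.Im (v x)))%R)%C.

Lemma integrable_scale d (T : measurableType d) (R : realType)
    (mu : {measure set T -> \bar R}) (D : set T) (c : R) (f : T -> R) :
  measurable D -> mu.-integrable D (EFin \o f) ->
  mu.-integrable D (EFin \o (fun x => c * f x)).
Proof. by move=> mD fi; exact: (integrableZl mD c fi). Qed.

Lemma Cintegral_pairing (R : realType) (D : set R) (c : R[i]) (h : R -> R)
    (v : R -> R[i]) : @measurable _ (measurableTypeR R) D ->
  sqint lebesgue_measure D h -> L2 D v ->
  Cintegral D (fun x => c * (h x)%:C%C * (v x)^*%C) = c * pairing D h v.
Proof.
move=> mD sh /(L2_sqint mD)[sr si].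
have ir := sqint_mul mD sh sr; have ii := sqint_mul mD sh si.
case: c => a b; rewrite /Cintegral /pairing.
apply/eqP; rewrite eq_complex /=; apply/andP; split; apply/eqP.
- rewrite (@eq_Rintegral _ _ R lebesgue_measure D (fun x => a * (h x * complex.Re (v x)) +
    b * (h x * complex.Im (v x)))); last first.
    by move=> x _ /=; case: (v x) => ? ? /=; ring.
  rewrite RintegralD//; [|exact: integrable_scale mD ir|exact: integrable_scale mD ii].
  by rewrite !RintegralZl// mulrN opprK.
- rewrite (@eq_Rintegral _ _ R lebesgue_measure D (fun x => b * (h x * complex.Re (v x)) -
    a * (h x * complex.Im (v x)))); last first.
    by move=> x _ /=; case: (v x) => ? ? /=; ring.
  rewrite RintegralB//; [|exact: integrable_scale mD ir|exact: integrable_scale mD ii].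
  by rewrite !RintegralZl// mulrN addrC.
Qed.

Lemma edge_standing_wave (R : realType) (D : set R) (w : R) (f : R -> R)
    (v0 v2 : R -> R[i]) (c : R[i]) (t : R) :
  @measurable _ (measurableTypeR R) D ->
  sqint lebesgue_measure D f -> sqint lebesgue_measure D (fun x => f x ^+ 3) ->
  L2 D v0 -> L2 D v2 -> (sqnormc c)%:C%C * c = c ->
  pairing D f v2 = pairing D (fun x => w * f x - f x ^+ 3) v0 ->
  exists d,
    is_Cderive (fun s => Cintegral D (fun x =>
      c * cexpi (w * s) * (f x)%:C%C * (v0 x)^*%C)) t d /\
    'i%C * d + Cintegral D (fun x => c * cexpi (w * t) * (f x)%:C%C * (v2 x)^*%C)
    + Cintegral D (fun x => (sqnormc (c * cexpi (w * t) * (f x)%:C%C))%:C%C *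
        (c * cexpi (w * t) * (f x)%:C%C) * (v0 x)^*%C) = 0.
Proof.
move=> mD sf sf3 L0 L2' cc E.
exists (c * ('i%C * w%:C%C * cexpi (w * t)) * pairing D f v0); split.
  rewrite (_ : (fun s => _) = (fun s => c * cexpi (w * s) * pairing D f v0)).
    exact: is_Cderive_cexpi.
  by apply/funext => s; rewrite Cintegral_pairing.
have Ef x : (sqnormc (c * cexpi (w * t) * (f x)%:C%C))%:C%C *
    (c * cexpi (w * t) * (f x)%:C%C) = c * cexpi (w * t) * (f x ^+ 3)%:C%C.
  have -> : (sqnormc (c * cexpi (w * t) * (f x)%:C%C)) = sqnormc c * f x ^+ 2.
    have h := cos2Dsin2 (w * t); case: c {cc} => a b; rewrite /sqnormc /=.
    rewrite -[X in _ = X * _](mulr1) -h; ring.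
  by rewrite -[in RHS]cc exprSr !rmorphM /=; ring.
rewrite (_ : (fun x => (sqnormc _)%:C%C * _ * _) =
  (fun x => c * cexpi (w * t) * (f x ^+ 3)%:C%C * (v0 x)^*%C)); last first.
  by apply/funext => x; rewrite Ef.
rewrite !Cintegral_pairing// E.
have -> : pairing D (fun x => w * f x - f x ^+ 3) v0 =
    w%:C%C * pairing D f v0 - pairing D (fun x => f x ^+ 3) v0.
  have [sr si] := L2_sqint mD L0.
  have H (u : R -> R) : sqint lebesgue_measure D u ->
      (\int[lebesgue_measure]_(x in D) ((w * f x - f x ^+ 3) * u x))%R =
      w * (\int[lebesgue_measure]_(x in D) (f x * u x))%R -
      (\int[lebesgue_measure]_(x in D) (f x ^+ 3 * u x))%R.
    move=> su; have i1 := sqint_mul mD sf su; have i3 := sqint_mul mD sf3 su.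
    rewrite -RintegralZl// -RintegralB//; last exact: integrable_scale mD i1.
    by apply: eq_Rintegral => x _; ring.
  rewrite /pairing !H//; apply/eqP; rewrite eq_complex /=.
  by apply/andP; split; apply/eqP; ring.
have i2 : 'i%C * 'i%C = -1 :> R[i] by rewrite -expr2 sqr_i.
rewrite (_ : 'i%C * _ = ('i%C * 'i%C) * (c * w%:C%C * cexpi (w * t) * pairing D f v0));
  last by ring.
by rewrite i2; ring.
Qed.

Lemma eq_pairing (R : realType) (D : set R) (f g : R -> R) (u v : R -> R[i]) :
  (\int[lebesgue_measure]_(x in D) (complex.Re (u x) * f x))%R =
  (\int[lebesgue_measure]_(x in D) (complex.Re (v x) * g x))%R ->
  (\int[lebesgue_measure]_(x in D) (complex.Im (u x) * f x))%R =
  (\int[lebesgue_measure]_(x in D) (complex.Im (v x) * g x))%R ->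
  pairing D f u = pairing D g v.
Proof.
have C (h w : R -> R) : (\int[lebesgue_measure]_(x in D) (h x * w x))%R =
    (\int[lebesgue_measure]_(x in D) (w x * h x))%R.
  by apply: eq_Rintegral => x _; rewrite mulrC.
by move=> hr hi; rewrite /pairing !(C f) hr hi !(C g).
Qed.

Section laplacian_pairing.
Context (R : realType) (L : R).
Variables (f f1 f2 : R -> R).
Hypotheses (df : forall x : R, is_derive x (1 : R) f (f1 x))
  (df1 : forall x : R, is_derive x (1 : R) f1 (f2 x)) (cf2 : continuous f2).

Lemma loop_laplacian (v : H2fun (loop_edge L)) : 0 < L ->
  v (- L) = v L -> h2_der v (- L) = h2_der v L -> f (- L) = f L ->
  f1 (- L) = f1 L ->
  pairing (loop_edge L) f (h1_der (h2_der v)) = pairing (loop_edge L) f2 v.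
Proof.
move=> L0 ev ev1 ef ef1; have LL : - L < L by lra.
have mI : @measurable _ (measurableTypeR R) (loop_edge L).
  exact: measurable_itv.
have [r0 i0 l0 _ w0] := H1funP v; have [r1 i1 l1 l2 w1] := H1funP (h2_der v).
rewrite (H2funP v) in w0.
have [w0r w0i] := weak_derivative_Re_Im w0.
have [w1r w1i] := weak_derivative_Re_Im w1.
have [s0r s0i] := L2_sqint mI l0; have [s1r s1i] := L2_sqint mI l1.
have [s2r s2i] := L2_sqint mI l2.
have W (g : R -> R) : {within closure (loop_edge L), continuous g} ->
    {within `[- L, L], continuous g}.
  by apply: continuous_subspaceW; exact: subset_closure_oo.
apply: eq_pairing.
- by apply: (green_periodic df df1 cf2 LL (W _ r0) (W _ r1) s0r s1r s2r w0r w1r);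
    rewrite ?ev ?ev1.
- by apply: (green_periodic df df1 cf2 LL (W _ i0) (W _ i1) s0i s1i s2i w0i w1i);
    rewrite ?ev ?ev1.
Qed.

Lemma ray_laplacian (v : H2fun (ray_edge L)) :
  sqint lebesgue_measure (ray_edge L) f ->
  sqint lebesgue_measure (ray_edge L) f1 ->
  sqint lebesgue_measure (ray_edge L) f2 ->
  h2_der v L = 0 -> f1 L = 0 ->
  pairing (ray_edge L) f (h1_der (h2_der v)) = pairing (ray_edge L) f2 v.
Proof.
move=> sf sf1 sf2 ev ef1.
have mI : @measurable _ (measurableTypeR R) (ray_edge L).
  exact: measurable_itv.
have [r0 i0 l0 _ w0] := H1funP v; have [r1 i1 l1 l2 w1] := H1funP (h2_der v).
rewrite (H2funP v) in w0.
have [w0r w0i] := weak_derivative_Re_Im w0.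
have [w1r w1i] := weak_derivative_Re_Im w1.
have [s0r s0i] := L2_sqint mI l0; have [s1r s1i] := L2_sqint mI l1.
have [s2r s2i] := L2_sqint mI l2.
have W (g : R -> R) : {within closure (ray_edge L), continuous g} ->
    {within `[L, +oo[, continuous g}.
  by apply: continuous_subspaceW; exact: subset_closure_oy.
apply: eq_pairing.
- by apply: (green_halfline df df1 cf2 (W _ r0) (W _ r1) s0r s1r s2r sf sf1 sf2
    w0r w1r); rewrite ?ev.
- by apply: (green_halfline df df1 cf2 (W _ i0) (W _ i1) s0i s1i s2i sf sf1 sf2
    w0i w1i); rewrite ?ev.
Qed.

End laplacian_pairing.

Lemma H1_sqdist_ge0 (R : realType) (I : set R) (u v : H1fun I) :
  0 <= H1_sqdist u v.
Proof.
by rewrite /H1_sqdist addr_ge0//; apply: Rintegral_ge0 => x _;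
  rewrite /sqnormc addr_ge0// sqr_ge0.
Qed.

Lemma H1_sqdist_ge (R : realType) (I : set R) (u v : H1fun I) (c d m : R) :
  @measurable _ (measurableTypeR R) I -> c < d -> `]c, d[%classic `<=` I ->
  0 <= m -> (forall x, c < x < d -> m <= sqnormc (u x - v x)) ->
  m * (d - c) <= H1_sqdist u v.
Proof.
move=> mI cd JI m0 muv.
have n0 z : 0 <= sqnormc z :> R by rewrite addr_ge0 ?sqr_ge0.
have mJ : @measurable _ (measurableTypeR R) `]c, d[%classic.
  exact: measurable_itv.
have [_ _ lu _ _] := H1funP u; have [_ _ lv _ _] := H1funP v.
have [ur ui] := L2_sqint mI lu; have [vr vi] := L2_sqint mI lv.
have iuv : lebesgue_measure.-integrable I
    (EFin \o (fun x => sqnormc (u x - v x))).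
  have [_ _] : L2 I (fun x => u x - v x); last by [].
  apply: sqint_L2 => //.
    have := sqint_sub mI ur vr; congr (sqint _ _ _).
    by apply/funext => x; case: (u x) (v x) => ? ? [].
  have := sqint_sub mI ui vi; congr (sqint _ _ _).
  by apply/funext => x; case: (u x) (v x) => ? ? [].
have iuvJ := integrableS mI mJ JI iuv.
rewrite /H1_sqdist -[leLHS]addr0; apply: lerD; last first.
  by apply: Rintegral_ge0 => x _.
have -> : m * (d - c) = (\int[lebesgue_measure]_(x in `]c, d[) m)%R.
  have E : lebesgue_measure (`]c, d[%classic : set R) = (d - c)%:E.
    by rewrite lebesgue_measure_itv/= lte_fin cd EFinB.
  transitivity (m * fine (lebesgue_measure (`]c, d[%classic : set R))).
    by rewrite E.
  by rewrite Rintegral_cst.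
apply: (@le_trans _ _
  (\int[lebesgue_measure]_(x in `]c, d[) sqnormc (u x - v x))%R).
  apply: le_Rintegral => //.
    apply: continuous_integrable_oo; apply: continuous_subspaceT => x.
    exact: cvg_cst.
apply: fine_le; [exact: integrable_fin_num|exact: integrable_fin_num|].
apply: ge0_subset_integral => //; first by case/integrableP: iuv.
by move=> x _; rewrite lee_fin.
Qed.

Lemma sqnormc_phase_cvg (R : realType) (c : R[i]) (w t : R) :
  sqnormc (c * cexpi (w * s) - c * cexpi (w * t)) @[s --> t] --> (0 : R).
Proof.
have -> : (fun s => sqnormc (c * cexpi (w * s) - c * cexpi (w * t))) =
    (fun s => sqnormc c * ((cos (w * s) - cos (w * t)) * (cos (w * s) - cos (w * t)) +
      (sin (w * s) - sin (w * t)) * (sin (w * s) - sin (w * t)))).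
  by apply/funext => s; case: c => a b; rewrite /sqnormc /=; ring.
have cc : cos (w * s) - cos (w * t) @[s --> t] --> (0 : R).
  rewrite -(subrr (cos (w * t))); apply: cvgB; last exact: cvg_cst.
  have d (y : R) : is_derive y (1 : R) (fun s => cos (w * s)) (w * - sin (w * y)).
    by apply: is_derive_comp_scale; exact: is_derive_cos.
  exact: (is_derive_continuous d).
have cs : sin (w * s) - sin (w * t) @[s --> t] --> (0 : R).
  rewrite -(subrr (sin (w * t))); apply: cvgB; last exact: cvg_cst.
  have d (y : R) : is_derive y (1 : R) (fun s => sin (w * s)) (w * cos (w * y)).
    by apply: is_derive_comp_scale; exact: is_derive_sin.
  exact: (is_derive_continuous d).
have h := cvgMl_tmp (a := sqnormc c) (cvgD (cvgM cc cc) (cvgM cs cs)).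
by rewrite mulr0 addr0 mulr0 in h; exact: h.
Qed.

Lemma sqnormc_phase_sub (R : realType) (s t p q : R) :
  sqnormc (cexpi s * p%:C%C - cexpi t * q%:C%C) =
  p ^+ 2 + q ^+ 2 - 2 * p * q * cos (s - t).
Proof.
rewrite /sqnormc /= cosB; have hs := cos2Dsin2 s; have ht := cos2Dsin2 t.
transitivity (p ^+ 2 * (cos s ^+ 2 + sin s ^+ 2) + q ^+ 2 * (cos t ^+ 2 + sin t ^+ 2)
  - 2 * p * q * (cos s * cos t + sin s * sin t)); first by ring.
by rewrite hs ht !mulr1.
Qed.

Lemma soliton_cube_sqint (R : realType) (L b : R) : 0 < b ->
  sqint lebesgue_measure (ray_edge L) (fun x => soliton L b x ^+ 3).
Proof.
move=> b0; have mI : @measurable _ (measurableTypeR R) (ray_edge L).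
  exact: measurable_itv.
have [_ _ sf _] := soliton_C1L2 L b0.
have bb : b <= b <= 2 * b by rewrite lexx; lra.
pose C := Num.sqrt 2 * (4 * b) : R.
have C0 : 0 <= C by rewrite !mulr_ge0 ?sqrtr_ge0 ?(ltW b0).
apply: sqint_le (sqint_scale (C ^+ 2) mI sf) => //.
  by apply: measurable_funX; case: sf.
move=> x; rewrite /ray_edge /= in_itv/= andbT => /ltW Lx.
rewrite normrX [leRHS]normrM [`|C ^+ 2|]ger0_norm ?sqr_ge0// exprSr.
rewrite ler_wpM2r// lerXn2r ?nnegrE//.
have [h _] := soliton_le b0 bb Lx; apply: le_trans h _.
rewrite ler_piMr// -expR0 ler_expR oppr_le0.
by rewrite mulr_ge0 ?subr_ge0// ltW.
Qed.

(** * The drifting wave *)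
Section drifting_wave.
Context (R : realType) (L : R) (N n : nat) (hL : 0 < L).
Variables (omega : R) (phi phi1 : R -> R).
Hypotheses (dphi : forall x : R, is_derive x (1 : R) phi (phi1 x))
  (dphi1 : forall x : R, is_derive x (1 : R) phi1 (omega * phi x - phi x ^+ 3))
  (phi_per : phi (- L) = phi L) (phi1_per : phi1 (- L) = phi1 L).

Let cphi : continuous phi := is_derive_continuous dphi.
Let cphi1 : continuous phi1 := is_derive_continuous dphi1.

Let mloop : @measurable _ (measurableTypeR R) (loop_edge L).
Proof. exact: measurable_itv. Qed.

Let mray : @measurable _ (measurableTypeR R) (ray_edge L).
Proof. exact: measurable_itv. Qed.

Lemma loop_C1L2 : C1L2 (loop_edge L) phi phi1.
Proof.
split; [exact: dphi|exact: cphi1|exact: continuous_sqint|exact: continuous_sqint].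
Qed.

Definition amplitude (j : 'I_N) : R[i] := if (j < n)%N then 1 else 0.

Definition drifting_wave (b : R) (hb : 0 < b) (t : R) : H1G L N :=
  MkH1G (H1_of_real mloop loop_C1L2 (1 * cexpi (omega * t)))
        (fun j => H1_of_real mray (soliton_C1L2 L hb)
                    (amplitude j * cexpi (b ^+ 2 * t))).

Lemma cubic_continuous (w : R) (f : R -> R) : continuous f ->
  continuous (fun x => w * f x - f x ^+ 3).
Proof.
move=> cf x; apply: cvgB; first by apply: cvgM; [exact: cvg_cst|exact: cf].
by under eq_fun do rewrite !exprS expr0 mulr1; apply: cvgM;
  [exact: cf|apply: cvgM; exact: cf].
Qed.

Lemma amplitude_cubic (j : 'I_N) :
  (sqnormc (amplitude j))%:C%C * amplitude j = amplitude j.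
Proof.
rewrite /amplitude; case: ifP => _; last by rewrite mulr0.
by rewrite /sqnormc /= expr1n expr0n addr0 mulr1.
Qed.

Lemma H1G_dist_drifting_wave (b : R) (hb : 0 < b) (s t : R) :
  H1G_dist (drifting_wave hb s) (drifting_wave hb t) = Num.sqrt
   (sqnormc (1 * cexpi (omega * s) - 1 * cexpi (omega * t)) *
     ((\int[lebesgue_measure]_(x in loop_edge L) (phi x) ^+ 2)%R
      + (\int[lebesgue_measure]_(x in loop_edge L) (phi1 x) ^+ 2)%R)
   + \sum_(j < N) sqnormc (amplitude j * cexpi (b ^+ 2 * s) -
                           amplitude j * cexpi (b ^+ 2 * t)) *
     ((\int[lebesgue_measure]_(x in ray_edge L) (soliton L b x) ^+ 2)%R
      + (\int[lebesgue_measure]_(x in ray_edge L) (soliton1 L b x) ^+ 2)%R)).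
Proof.
rewrite /H1G_dist /= H1_sqdist_phase; congr (Num.sqrt (_ + _)).
by apply: eq_bigr => j _; rewrite H1_sqdist_phase.
Qed.

Lemma drifting_wave_solution (b : R) (hb : 0 < b) :
  nls_solution setT (drifting_wave hb).
Proof.
split.
- by split=> //; exact: openT.
- by move=> t _; rewrite /energy_space /= phi_per.
- move=> t _.
  under eq_fun do rewrite H1G_dist_drifting_wave.
  have h0 (c : R[i]) (w E : R) :
      sqnormc (c * cexpi (w * s) - c * cexpi (w * t)) * E @[s --> t] --> (0 : R).
    have h := cvgMr_tmp (b := E) (sqnormc_phase_cvg c w t).
    by rewrite mul0r in h; exact: h.
  have hsqrt (G : R -> R) : G s @[s --> t] --> (0 : R) ->
      Num.sqrt (G s) @[s --> t] --> (0 : R).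
    move=> hG; have h := cvg_comp _ _ hG (@sqrt_continuous R 0).
    by rewrite sqrtr0 in h; exact: h.
  have hsum (F : 'I_N -> R -> R) : (forall j, F j s @[s --> t] --> (0 : R)) ->
      (\sum_(j < N) F j s) @[s --> t] --> (0 : R).
    move=> hF; elim: (index_enum 'I_N) => [|j r IH].
      by under eq_fun do rewrite big_nil; exact: cvg_cst.
    under eq_fun do rewrite big_cons.
    by have h := cvgD (hF j) IH; rewrite addr0 in h; exact: h.
  apply: hsqrt; have h := cvgD (h0 1 omega _) (hsum _ (fun j => h0 (amplitude j) (b ^+ 2) _)).
  by rewrite addr0 in h; exact: h.
- move=> V [V0 V1 V2] t _.
  have c2 := cubic_continuous (w := omega) cphi.
  have [r0 i0 l0 _ w0] := H1funP (h2_loop V).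
  have [_ _ _ l2 _] := H1funP (h2_der (h2_loop V)).
  have one : (sqnormc 1)%:C%C * 1 = 1 :> R[i].
    by rewrite /sqnormc /= expr1n expr0n addr0 mulr1.
  have s3 : sqint lebesgue_measure (loop_edge L) (fun x => phi x ^+ 3).
    apply: continuous_sqint => x.
    by under eq_fun do rewrite !exprS expr0 mulr1; apply: cvgM;
      [exact: cphi|apply: cvgM; exact: cphi].
  have s1 : sqint lebesgue_measure (loop_edge L) phi by exact: continuous_sqint.
  have [d0 [D0 E0]] := edge_standing_wave t mloop s1 s3 l0 l2 one
    (loop_laplacian dphi dphi1 c2 hL V0 V1 phi_per phi1_per).
  have /choice[d_ Hd] : forall j : 'I_N, exists d,
      is_Cderive (fun s => Cintegral (ray_edge L) (fun x =>
        amplitude j * cexpi (b ^+ 2 * s) * (soliton L b x)%:C%C *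
        (h2_ray V j x)^*%C)) t d /\
      'i%C * d + Cintegral (ray_edge L) (fun x =>
        amplitude j * cexpi (b ^+ 2 * t) * (soliton L b x)%:C%C *
        (h1_der (h2_der (h2_ray V j)) x)^*%C)
      + Cintegral (ray_edge L) (fun x =>
        (sqnormc (amplitude j * cexpi (b ^+ 2 * t) * (soliton L b x)%:C%C))%:C%C *
        (amplitude j * cexpi (b ^+ 2 * t) * (soliton L b x)%:C%C) *
        (h2_ray V j x)^*%C) = 0.
    move=> j; have [_ c1' sf sf1] := soliton_C1L2 L hb.
    have [_ _ lj0 _ _] := H1funP (h2_ray V j).
    have [_ _ _ lj2 _] := H1funP (h2_der (h2_ray V j)).
    have sf3 := soliton_cube_sqint L hb.
    have sf2 := sqint_sub mray (sqint_scale (b ^+ 2) mray sf) sf3.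
    have cs := cubic_continuous (w := b ^+ 2)
      (is_derive_continuous (is_derive_soliton L b)).
    exact: (edge_standing_wave t mray sf sf3 lj0 lj2 (amplitude_cubic j)
      (ray_laplacian (is_derive_soliton L b) (is_derive_soliton1 L b) cs
        sf sf1 sf2 (V2 j) (soliton1_0 L b))).
  exists (d0 + \sum_(j < N) d_ j); split.
    apply: is_CderiveD; first exact: D0.
    by apply: is_Cderive_sum => j; case: (Hd j).
  have alg (i d x y : R[i]) (D X Y : 'I_N -> R[i]) : i * d + x + y = 0 ->
      (forall j, i * D j + X j + Y j = 0) ->
      i * (d + \sum_(j < N) D j) + (x + \sum_(j < N) X j)
      + (y + \sum_(j < N) Y j) = 0.
    move=> e ej; rewrite mulrDr mulr_sumr.
    transitivity ((i * d + x + y) +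
      (\sum_(j < N) i * D j + \sum_(j < N) X j + \sum_(j < N) Y j)); first by ring.
    rewrite e add0r -!big_split /=; apply: big1 => j _; exact: ej.
  by apply: alg; [exact: E0|move=> j; case: (Hd j)].
Qed.

Lemma drifting_wave_maximal (b : R) (hb : 0 < b) :
  maximal_nls_solution setT (drifting_wave hb).
Proof.
split; first exact: drifting_wave_solution.
by move=> J' U' _ JJ' _; apply/seteqP; split.
Qed.

Lemma soliton_lower_bound (a x : R) : 0 < a -> L < x < L + 1 ->
  Num.sqrt 2 * a * (2 / (expR a + 1)) <= soliton L a x.
Proof.
move=> a0 /andP[Lx xL]; rewrite /soliton /sech.
have den y : 0 < expR y + expR (- y) by rewrite addr_gt0 ?expR_gt0.
rewrite ler_wpM2l// ?mulr_ge0 ?sqrtr_ge0 ?(ltW a0)// ler_wpM2l//.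
rewrite lef_pV2 ?posrE//; last by rewrite addr_gt0 ?expR_gt0.
have h0 : 0 <= a * (x - L) by rewrite mulr_ge0 ?subr_ge0 ?ltW.
apply: lerD; first by rewrite ler_expR; nra.
by rewrite -expR0 ler_expR oppr_le0.
Qed.

Lemma drifting_wave_far (a b m t theta s : R) (hb : 0 < b) (V : H1G L N) :
  0 < a -> 0 < m -> (0 < n <= N)%N -> (forall x, m <= phi x) ->
  (b ^+ 2 - omega) * t = pi ->
  (forall x : R, - L <= x <= L ->
     h1_loop V x = cexpi theta * (phi (x + s))%:C%C) ->
  (forall (j : 'I_N) x, (j < n)%N -> L <= x ->
     h1_ray V j x = cexpi theta * (soliton L a x)%:C%C) ->
  Num.sqrt (Num.min (m ^+ 2 * (L - - L))
    ((Num.sqrt 2 * a * (2 / (expR a + 1))) ^+ 2 * (L + 1 - L)))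
  <= H1G_dist (drifting_wave hb t) V.
Proof.
move=> a0 m0 /andP[n0 nN] phim tpi Vl Vr.
set m1 := Num.sqrt 2 * a * _.
have m10 : 0 <= m1.
  by rewrite !mulr_ge0 ?sqrtr_ge0 ?(ltW a0)// invr_ge0 addr_ge0 ?expR_ge0.
have sum0 : 0 <= \sum_(j < N) H1_sqdist (h1_ray (drifting_wave hb t) j) (h1_ray V j).
  by apply: sumr_ge0 => j _; exact: H1_sqdist_ge0.
rewrite /H1G_dist ler_sqrt; last by rewrite addr_ge0 ?H1_sqdist_ge0.
rewrite ge_min; apply/orP.
have [c0|c0] := leP (cos (omega * t - theta)) 0; [left|right].
  apply: le_trans (_ : H1_sqdist (h1_loop (drifting_wave hb t)) (h1_loop V) <= _);
    last by rewrite lerDl.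
  apply: (H1_sqdist_ge mloop) => //; [by have := hL; lra|exact: sqr_ge0|].
  move=> x /andP[x1 x2]; rewrite Vl ?(ltW x1) ?(ltW x2)//= mul1r.
  rewrite sqnormc_phase_sub; have h1 := phim x; have h2 := phim (x + s).
  set p := phi x in h1 *; set q := phi (x + s) in h2 *.
  set c := cos _ in c0 *.
  have pq : 0 <= p * q by rewrite mulr_ge0//; lra.
  have : p * q * c <= 0 by rewrite mulr_ge0_le0.
  have : m ^+ 2 <= p ^+ 2 by rewrite lerXn2r ?nnegrE//; lra.
  by have := sqr_ge0 q; lra.
pose j0 := Ordinal (leq_trans n0 nN).
apply: le_trans (_ : H1_sqdist (h1_ray (drifting_wave hb t) j0) (h1_ray V j0) <= _);
  last first.
  rewrite (bigD1 j0)//= addrCA lerDl addr_ge0 ?H1_sqdist_ge0//.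
  by apply: sumr_ge0 => j _; exact: H1_sqdist_ge0.
apply: (H1_sqdist_ge mray) => //; [by rewrite ltrDl|exact: subset_itvl|exact: sqr_ge0|].
move=> x /andP[x1 x2]; rewrite Vr ?(ltW x1)//= /amplitude n0 mul1r.
have -> : b ^+ 2 * t = omega * t + pi by rewrite -tpi; ring.
rewrite sqnormc_phase_sub (addrAC (omega * t)) cosDpi.
have h1 := soliton_gt0 L x hb; have h2 := soliton_gt0 L x a0.
have h3 : m1 <= soliton L a x by apply: soliton_lower_bound; rewrite ?x1.
set p := soliton L b x in h1 *; set q := soliton L a x in h2 h3 *.
set c := cos _ in c0 *.
have : 0 <= p * q * c.
  by apply: mulr_ge0; [apply: mulr_ge0|]; exact: ltW.
have : m1 ^+ 2 <= q ^+ 2 by rewrite lerXn2r ?nnegrE// ltW.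
by have := sqr_ge0 p; lra.
Qed.

Lemma drifting_wave_close (a b : R) (ha : 0 < a) (hb : 0 < b) :
  H1G_dist (drifting_wave hb 0) (drifting_wave ha 0) <= Num.sqrt (N%:R *
   ((\int[lebesgue_measure]_(x in `]L, +oo[) (soliton L b x - soliton L a x) ^+ 2)%R
   + (\int[lebesgue_measure]_(x in `]L, +oo[)
        (soliton1 L b x - soliton1 L a x) ^+ 2)%R)).
Proof.
set E := (_ + _ : R).
have E0 : 0 <= E by rewrite addr_ge0//; apply: Rintegral_ge0 => x _; exact: sqr_ge0.
rewrite /H1G_dist /= !mulr0 ler_sqrt ?mulr_ge0//.
rewrite H1_sqdist_phase subrr {1}/sqnormc /= expr0n addr0 mul0r add0r.
rewrite (@le_trans _ _ (\sum_(j < N) E))//; last first.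
  by rewrite sumr_const card_ord mulr_natl.
apply: ler_sum => j _; rewrite H1_sqdist_of_real -/E ler_piMl//.
by rewrite /amplitude; case: ifP => _; rewrite /sqnormc /= cos0 sin0; lra.
Qed.

End drifting_wave.

Unset Implicit Arguments.
Set Strict Implicit.

Theorem theorem5p7 (R : realType) (L : R) (N : nat)
    (hL : 0 < L) (hN : (1 <= N)%N)
    (n : nat) (hn : (1 <= n <= N)%N)
    (omega : R) (homega : pi ^+ 2 / (2 * L ^+ 2) < omega)
    (eta1 eta2 k : R) (hparam : dnoidal_parameters L omega eta1 eta2 k) :
  orbitally_unstable (@Phi_orbit R L N n omega eta1 k).
Proof.
have [/andP[e20 e21] e12 hk kE [_ per _]] := hparam.
have e10 : 0 < eta1 by exact: lt_trans e21.
have o0 : 0 < omega.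
  have : 0 < eta1 ^+ 2 + eta2 ^+ 2 by rewrite addr_gt0 ?exprn_gt0.
  by rewrite e12 pmulr_rgt0.
have hom : eta1 ^+ 2 * (2 - k ^+ 2) = 2 * omega.
  have h : 2 * omega - eta2 ^+ 2 = eta1 ^+ 2 by rewrite -e12 addrK.
  rewrite kE h -e12; field.
  by rewrite gt_eqF.
have [f1 [df df1]] := dnoidal_ode hk hom.
set f := dnoidal eta1 k in df df1.
have shift (g : R -> R) : periodic g (2 * L) -> g (- L) = g L.
  by move=> pg; rewrite -[LHS]pg; congr g; ring.
have pf := shift _ per; have pf1 := shift _ (periodic_derive df per).
pose a := Num.sqrt omega; have a0 : 0 < a by rewrite sqrtr_gt0.
have a2 : a ^+ 2 = omega by rewrite sqr_sqrtr// ltW.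
pose m := eta1 * Num.sqrt (1 - k ^+ 2).
have m0 : 0 < m by rewrite mulr_gt0// sqrtr_gt0 jacobi_modulus_gt0.
have fm x : m <= f x by rewrite ler_wpM2l ?(ltW e10)// jacobi_dn_ge.
move=> stable.
pose m1 := Num.sqrt 2 * a * (2 / (expR a + 1)).
have m10 : 0 < m1.
  by rewrite !mulr_gt0 ?sqrtr_gt0 ?invr_gt0 ?addr_gt0 ?expR_gt0.
pose eps := Num.sqrt (Num.min (m ^+ 2 * (L - - L)) (m1 ^+ 2 * (L + 1 - L))).
have eps0 : 0 < eps.
  rewrite sqrtr_gt0 lt_min; apply/andP; split.
    by rewrite mulr_gt0 ?exprn_gt0//; lra.
  by rewrite mulr_gt0 ?exprn_gt0//; lra.
have [delta [delta0 Hd]] := stable eps eps0.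
pose b_ (i : nat) : R := a * (1 + i.+1%:R^-1).
have inv1 i : 0 < (i.+1%:R^-1 : R) <= 1.
  by rewrite invr_gt0 ltr0n /= invf_le1 ?ler1n.
have hb i : a <= b_ i <= 2 * a.
  have /andP[/ltW h1 h2] := inv1 i.
  have ah0 := mulr_ge0 (ltW a0) h1; have ah1 := ler_piMr (ltW a0) h2.
  by rewrite /b_ mulrDr mulr1 lerDl ah0 mulr_natl mulr2n lerD2l.
have ba : b_ i @[i --> \oo] --> a.
  apply/cvgrPdist_le => e e1; have ea : 0 < e / a by rewrite divr_gt0.
  have := near_infty_natSinv_lt (PosNum ea); apply: filterS => i /=.
  rewrite ltr_pdivlMr// => h; have /andP[h1 _] := inv1 i.
  rewrite /b_ (_ : a - _ = - (i.+1%:R^-1 * a)); last by ring.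
  by rewrite normrN ger0_norm ?mulr_ge0 ?(ltW h1) ?(ltW a0)// ltW.
have d0 : 0 < delta ^+ 2 / N%:R by rewrite divr_gt0 ?exprn_gt0// ltr0n.
have /cvgrPdist_lt /(_ _ d0) [i0 _ /(_ _ (leqnn i0))] :=
  soliton_H1_cvg L a0 hb ba.
rewrite sub0r normrN; set b := b_ i0; set E := (_ + _ : R) => hE.
have /andP[ab b2] : a <= b <= 2 * a := hb i0.
have b0 : 0 < b := lt_le_trans a0 ab.
have abs : a < b.
  by have /andP[h1 _] := inv1 i0; rewrite /b /b_ ltr_pMr// ltrDl.
pose U := drifting_wave L N n df df1 b0 : R -> H1G L N.
pose Phi := drifting_wave L N n df df1 a0 : R -> H1G L N.
have PhiO : Phi_orbit n omega eta1 k (Phi 0).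
  exists 0, 0; split=> [x _|j x _] /=; rewrite mulr0.
    by rewrite mul1r addr0.
  rewrite /amplitude; case: ifP => _; last by rewrite !mul0r.
  by rewrite mul1r half_soliton_soliton.
have close : (H1G_dist_set (U 0%R) (@Phi_orbit R L N n omega eta1 k) < delta%:E)%E.
  apply: le_lt_trans (_ : (H1G_dist (U 0%R) (Phi 0%R))%:E < _)%E.
    by apply: ereal_inf_lbound; exists (Phi 0).
  rewrite lte_fin; apply: le_lt_trans (drifting_wave_close L N n df df1 a0 b0) _.
  rewrite -/E -(ger0_norm (ltW delta0)) -sqrtr_sqr ltr_sqrt ?exprn_gt0//.
  rewrite mulrC -ltr_pdivlMr ?ltr0n//.
  by apply: le_lt_trans hE; exact: ler_norm.
have [_ far] := Hd setT U (drifting_wave_maximal N n hL df df1 pf pf1 b0) close.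
pose t := pi / (b ^+ 2 - omega).
have [_ [V [theta [s [Vl Vr]]] <-]] := ereal_inf_lt (far t).
rewrite lte_fin ltNge => /negP; apply.
apply: (@drifting_wave_far R L N n hL omega f f1 df df1 a b m t theta s b0 V) => //.
- rewrite mulrC divfK// gt_eqF// subr_gt0 -a2.
  by rewrite ltrXn2r ?nnegrE ?(ltW a0) ?(ltW b0).
- by move=> j x jn Lx; rewrite Vr// jn half_soliton_soliton.
Qed.
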